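(* For each $n\ge1$ let $(\mathscr{X}_n,+)$ be a finite abelian group of size $N_n=|\mathscr{X}_n|\ge3$, let $S_n\subseteq\mathscr{X}_n$ be a symmetric ($S_n=-S_n$) generating set with $d_n=|S_n|$ elements, and let $P_n$ be the transition matrix of simple random walk on the Cayley graph $\mathrm{Cay}(\mathscr{X}_n,S_n)$, namely $P_n(x,y)=\frac{1}{|S_n|}\sum_{z\in S_n}\mathbf{1}_{(y=x+z)}$. Let $\mathrm{t}_{\mathrm{mix}}^{(n)}(\cdot)$ and $\mathrm{t}_{\mathrm{rel}}^{(n)}$ be the mixing times and relaxation time of $P_n$. If $$\mathrm{t}_{\mathrm{rel}}^{(n)}\cdot\frac{(\log d_n)^{3/2}}{(\log N_n)^{1/2}}\xrightarrow[n\to\infty]{}0,$$ then the sequence exhibits cutoff, i.e. for every fixed $\varepsilon\in(0,1)$, $\mathrm{t}_{\mathrm{mix}}^{(n)}(1-\varepsilon)/\mathrm{t}_{\mathrm{mix}}^{(n)}(\varepsilon)\to1$ as $n\to\infty$.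
   Context: For an irreducible stochastic matrix $P$ on a finite set $\mathscr{X}$ with invariant law $\pi$: the heat kernel is $\mathscr{P}_t(x,y)=e^{-t}\sum_{k\ge 0}\frac{P^k(x,y)t^k}{k!}$, $t\ge0$; the mixing time is $\mathrm{t}_{\mathrm{mix}}(\varepsilon)=\min\{t\ge 0:\max_{x}\|\mathscr{P}_t(x,\cdot)-\pi\|_{\mathrm{TV}}\le\varepsilon\}$ for $\varepsilon\in(0,1)$, with $\|\mu-\pi\|_{\mathrm{TV}}=\max_{A\subseteq\mathscr{X}}|\mu(A)-\pi(A)|$; the relaxation time $\mathrm{t}_{\mathrm{rel}}$ is the optimal constant in $\mathrm{Var}_\pi(f)\le \mathrm{t}_{\mathrm{rel}}\,\mathbf{E}_\pi[\Gamma(f,f)]$ for all $f:\mathscr{X}\to\mathbb{R}$, where $\Gamma(f,f)(x)=\frac12\sum_yP(x,y)(f(y)-f(x))^2$ (i.e. the inverse spectral gap of $P$ when $P$ is reversible, as is the case here). *)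

(* Defs.v *)
From mathcomp Require Export all_boot all_order all_algebra all_fingroup.
From mathcomp Require Export all_classical all_reals all_analysis.

Set Implicit Arguments.
Unset Strict Implicit.
Unset Printing Implicit Defensive.

Import Order.TTheory GRing.Theory Num.Theory.
Import numFieldNormedType.Exports.

Local Open Scope ring_scope.

(* A real matrix indexed by a finite set X is a function P : X -> X -> R, and a
   real measure on X is given by its mass function X -> R. *)

Definition is_law (R : realType) (X : finType) (mu : X -> R) : Prop :=
  (forall x, 0 <= mu x) /\ \sum_x mu x = 1.

Definition invariant_law (R : realType) (X : finType) (P : X -> X -> R)
    (pi : X -> R) : Prop :=
  is_law pi /\ forall y, \sum_x pi x * P x y = pi y.

Fixpoint kernel_pow (R : realType) (X : finType) (P : X -> X -> R) (k : nat)
    (x y : X) : R :=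
  if k is k'.+1 then \sum_z P x z * kernel_pow P k' z y else (x == y)%:R.

Definition heat_kernel (R : realType) (X : finType) (P : X -> X -> R) (t : R)
    (x y : X) : R :=
  expR (- t) *
  limn (series (fun k : nat => kernel_pow P k x y * t ^+ k / (k`!)%:R)).

(* The neutral element 0 of the maxima below is harmless: all terms are
   nonnegative. *)
Definition tv_dist (R : realType) (X : finType) (mu nu : X -> R) : R :=
  \big[Num.max/0]_(A : {set X}) `| \sum_(x in A) mu x - \sum_(x in A) nu x |.

Definition worst_tv (R : realType) (X : finType) (P : X -> X -> R)
    (pi : X -> R) (t : R) : R :=
  \big[Num.max/0]_(x : X) tv_dist (heat_kernel P t x) pi.

(* The infimum is a minimum when P is irreducible: the set is then nonempty by
   convergence to equilibrium, and closed because t |-> worst_tv P pi t is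
   continuous. *)
Definition t_mix (R : realType) (X : finType) (P : X -> X -> R) (pi : X -> R)
    (eps : R) : R :=
  inf [set t : R | 0 <= t /\ worst_tv P pi t <= eps]%classic.

Definition expect (R : realType) (X : finType) (pi : X -> R) (f : X -> R) : R :=
  \sum_x pi x * f x.

Definition variance (R : realType) (X : finType) (pi : X -> R) (f : X -> R) : R :=
  expect pi (fun x => (f x - expect pi f) ^+ 2).

(* Gamma(f, f). *)
Definition carre_du_champ (R : realType) (X : finType) (P : X -> X -> R)
    (f : X -> R) (x : X) : R :=
  2^-1 * \sum_y P x y * (f y - f x) ^+ 2.

(* The optimal (smallest) constant in the Poincare inequality. *)
Definition t_rel (R : realType) (X : finType) (P : X -> X -> R) (pi : X -> R) : R :=
  inf [set c : R | forall f : X -> R,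
         variance pi f <= c * expect pi (carre_du_champ P f)]%classic.

Definition cayley_walk (R : realType) (X : finZmodType) (S : {set X})
    (x y : X) : R :=
  (#|S|%:R)^-1 * \sum_(z in S) (y == x + z)%:R.

Definition cutoff (R : realType) (tmix : nat -> R -> R) : Prop :=
  forall eps : R, 0 < eps < 1 ->
    ((fun n => tmix n (1 - eps) / tmix n eps) @ \oo --> (1 : R))%classic.

(* Main.v *)
(* Let p be the law of the walk at time t.  If p is at distance at most 1 - eps
   from uniform, then Chebyshev's inequality for ln p bounds the relative entropy
   of p by its varentropy V (the variance of ln p under p), and the L2
   contraction applied to p truncated at its typical values shows that a further
   time of order t_rel * (1 + sqrt V) brings the distance below eps.  On an
   abelian group, translations commute with the semigroup, which gives the local
   Poincare inequality Var_p(f) <= 2 t E_p[Gamma f]; for f = ln p its right-hand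
   side is O(t (ln d)^2), where d is the number of generators.  Hence the window is
   O(t_rel * ln d * sqrt t), while counting words shows t >= c ln N / ln d, and
   the ratio of the two is O(t_rel * (ln d)^(3/2) / (ln N)^(1/2)). *)
Require Import Defs.
From mathcomp Require Import ring lra.

Set Implicit Arguments.
Unset Strict Implicit.
Unset Printing Implicit Defensive.

Import Order.TTheory GRing.Theory Num.Theory.
Import numFieldNormedType.Exports.

Local Open Scope ring_scope.

(** * The heat kernel of a finite chain *)

(** From a point mass, L2 contraction would cost a time of order [t_rel * ln N], too much for
    cutoff. Restarted from the part of [p] where [ln p <= D + sigma], with [D] the [p]-mean of
    [ln p], it costs [t_rel / 2] times [ln N + D + sigma] up to constants; and [ln N + D], the
    relative entropy, is itself at most [sigma] plus a constant. Only the fluctuation scale [sigma]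
    of [ln p] remains. The obstacle is then that increments of [ln p] admit no good pointwise bound:
    [p y / p (y + s)] can be large at points [y] that take many jumps to reach. Such ratios are
    controlled in [p]-mean only, so squared logarithms are first replaced by bounds linear in the
    ratios, and [ln d] alone stays squared. *)

Section ExponentialSeries.
Local Open Scope classical_set_scope.

(** Entries of the heat kernel are [exp (- t)] times such exponential generating functions, on which
    differentiation is a shift of the sequence; coefficients bounded by 1 are all that convergence
    needs. *)
Definition egf (R : realType) (a : nat -> R) (t : R) : R :=
  limn (series (fun k : nat => a k * t ^+ k / k`!%:R)).

Lemma is_cvg_egf (R : realType) (a : nat -> R) (t : R) :
  (forall k, `|a k| <= 1) -> cvgn (series (fun k : nat => a k * t ^+ k / k`!%:R)).
Proof.
move=> a1; apply: normed_cvg.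
apply: (@series_le_cvg R _ (exp_coeff `|t|)) => [n|n|n|]; first exact: normr_ge0.
- exact: exp_coeff_ge0.
- rewrite /exp_coeff /= !normrM normrX normfV [`|n`!%:R|]ger0_norm//.
  by rewrite -mulrA ler_piMl// mulr_ge0// ?exprn_ge0// invr_ge0.
- exact: is_cvg_series_exp_coeff.
Qed.

Lemma egfE (R : realType) (a : nat -> R) :
  egf a = fun t => limn (pseries (fun k => a k / k`!%:R) t).
Proof.
apply/funext => t; rewrite /egf /pseries; congr (limn (series _)).
by apply/funext => k /=; rewrite mulrAC.
Qed.

Lemma is_cvg_pseries_egf (R : realType) (a : nat -> R) (t : R) :
  (forall k, `|a k| <= 1) -> cvgn (pseries (fun k => a k / k`!%:R) t).
Proof.
move=> a1; have := @is_cvg_egf _ a t a1; rewrite /pseries.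
rewrite (_ : (fun k => a k * t ^+ k / k`!%:R) = fun k => a k / k`!%:R * t ^+ k)//.
by apply/funext => k /=; rewrite mulrAC.
Qed.

Lemma pseries_diffs_egf (R : realType) (a : nat -> R) :
  pseries_diffs (fun k => a k / k`!%:R) = fun k => a k.+1 / k`!%:R.
Proof.
apply/funext => k; rewrite /pseries_diffs factS natrM invfM.
rewrite mulrCA; congr (_ * _).
by rewrite mulVKf// pnatr_eq0.
Qed.

Lemma is_derive_egf (R : realType) (a : nat -> R) (t : R) :
  (forall k, `|a k| <= 1) ->
  is_derive t (1 : R) (egf a) (egf (fun k => a k.+1) t).
Proof.
move=> a1; rewrite !egfE -pseries_diffs_egf.
(* Termwise differentiation asks for convergence of the series and of its first two formal
   derivatives at some point beyond [|t|]. *)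
apply: (@pseries_snd_diffs R _ (`|t| + 1)).
- exact: is_cvg_pseries_egf.
- by rewrite pseries_diffs_egf; exact: is_cvg_pseries_egf.
- by rewrite !pseries_diffs_egf; exact: is_cvg_pseries_egf.
- by rewrite [ltRHS]ger0_norm ?addr_ge0// ltrDl.
Qed.

Lemma egf_sum (R : realType) (I : finType) (c : I -> R) (a : I -> nat -> R) (t : R) :
  (forall i k, `|a i k| <= 1) ->
  egf (fun k => \sum_i c i * a i k) t = \sum_i c i * egf (a i) t.
Proof.
move=> a1; rewrite /egf; apply: cvg_lim => //.
rewrite [X in X @ _ --> _](_ : _ =
  (fun n => \sum_i c i * series (fun k : nat => a i k * t ^+ k / k`!%:R) n)); last first.
  apply/funext => n; rewrite /series /=.
  under eq_bigr do rewrite mulr_suml mulr_suml.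
  rewrite exchange_big; apply: eq_bigr => i _; rewrite mulr_sumr.
  by apply: eq_bigr => k _; rewrite !mulrA.
apply: cvg_big; first exact: add_continuous.
by move=> i _; apply: cvgMl_tmp; exact: is_cvg_egf.
Qed.

Lemma egf_ge0 (R : realType) (a : nat -> R) (t : R) :
  (forall k, 0 <= a k <= 1) -> 0 <= t -> 0 <= egf a t.
Proof.
move=> a01 t0; apply: limr_ge.
  by apply: is_cvg_egf => k; have /andP[a0 a1] := a01 k; rewrite ger0_norm.
near=> n; apply: sumr_ge0 => k _; have /andP[a0 _] := a01 k.
by rewrite !mulr_ge0// ?exprn_ge0// invr_ge0.
Unshelve. all: by end_near. Qed.

Lemma egf_partial_sum_le (R : realType) (a : nat -> R) (t : R) n :
  (forall k, 0 <= a k <= 1) -> 0 <= t ->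
  \sum_(0 <= k < n) a k * t ^+ k / k`!%:R <= egf a t.
Proof.
move=> a01 t0.
apply: (@nondecreasing_cvgn_le R (series (fun k : nat => a k * t ^+ k / k`!%:R))).
  apply/nondecreasing_seqP => k; rewrite /series /= big_nat_recr//= lerDl.
  have /andP[a0 _] := a01 k.
  by rewrite !mulr_ge0// ?exprn_ge0// invr_ge0.
by apply: is_cvg_egf => k; have /andP[a0 a1] := a01 k; rewrite ger0_norm.
Qed.

(* The left-hand side is [t] times a partial sum of the derivative. *)
Lemma egf_moment_le (R : realType) (a : nat -> R) (t : R) n :
  (forall k, 0 <= a k <= 1) -> 0 <= t ->
  \sum_(0 <= k < n) k%:R * (a k * t ^+ k / k`!%:R) <= t * egf (fun k => a k.+1) t.
Proof.
move=> a01 t0; case: n => [|n].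
  by rewrite big_geq// mulr_ge0// egf_ge0.
rewrite big_nat_recl//= mul0r add0r.
rewrite (eq_bigr (fun k => t * (a k.+1 * t ^+ k / k`!%:R))); last first.
  move=> k _; rewrite factS natrM exprS invfM.
  have k0 : k.+1%:R != 0 :> R by rewrite pnatr_eq0.
  have f0 : k`!%:R != 0 :> R by rewrite pnatr_eq0 -lt0n fact_gt0.
  by field; rewrite -?nat1r f0 ?k0 //= nat1r k0.
rewrite -mulr_sumr ler_wpM2l//; exact: egf_partial_sum_le.
Qed.

Lemma egf0 (R : realType) (a : nat -> R) : egf a 0 = a 0%N.
Proof.
(* The partial sum of index 0 is empty; after a shift by one the partial sums at [t = 0] are
   constant. *)
rewrite /egf; apply: cvg_lim => //; rewrite -cvg_shiftS /=.
rewrite [X in X @ _ --> _](_ : _ = cst (a 0%N)); first exact: cvg_cst.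
apply/funext => n; rewrite /series /= big_nat_recl//= big1 ?addr0; last first.
  by move=> i _; rewrite exprS mul0r mulr0 mul0r.
by rewrite expr0 mulr1 fact0 divr1.
Qed.

End ExponentialSeries.

Definition stochastic (R : realType) (X : finType) (P : X -> X -> R) : Prop :=
  (forall x y, 0 <= P x y) /\ forall x, \sum_y P x y = 1.

Definition symmetric_kernel (R : realType) (X : finType) (P : X -> X -> R) : Prop :=
  forall x y, P x y = P y x.

Lemma sum_delta (R : realType) (X : finType) (f : X -> R) (x : X) :
  \sum_y (x == y)%:R * f y = f x.
Proof.
rewrite (bigD1 x)//= eqxx mul1r big1 ?addr0// => y /negbTE.
by rewrite eq_sym => ->; rewrite mul0r.
Qed.

Lemma is_derive_fsum (R : realType) (I : finType) (h : I -> R -> R) (dh : I -> R) (t : R) :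
  (forall i, is_derive t (1 : R) (h i) (dh i)) ->
  is_derive t (1 : R) (fun u => \sum_i h i u) (\sum_i dh i).
Proof.
move=> hd; rewrite (_ : (fun u => _) = \sum_i h i); last first.
  by apply/funext => u; rewrite fct_sumE.
by elim/big_ind2 : _ => // [|] *; [exact: is_derive_cst|exact: is_deriveD].
Qed.

Lemma kernel_powSr (R : realType) (X : finType) (P : X -> X -> R) k x y :
  kernel_pow P k.+1 x y = \sum_z kernel_pow P k x z * P z y.
Proof.
elim: k x y => [x y|k IH x y] /=.
  rewrite sum_delta; under eq_bigr do rewrite mulrC eq_sym.
  by rewrite sum_delta.
under eq_bigr => z _ do rewrite -/(kernel_pow P k.+1 z y) IH mulr_sumr.
rewrite exchange_big /=; apply: eq_bigr => z _; rewrite mulr_suml.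
by apply: eq_bigr => w _; rewrite mulrA.
Qed.

Section HeatKernel.
Variables (R : realType) (X : finType) (P : X -> X -> R).
Hypothesis stochP : stochastic P.

Lemma kernel_pow_ge0 k x y : 0 <= kernel_pow P k x y.
Proof.
elim: k x y => [x y|k IH x y] /=; first exact: ler0n.
by apply: sumr_ge0 => z _; rewrite mulr_ge0// stochP.1.
Qed.

Lemma sum_kernel_pow k x : \sum_y kernel_pow P k x y = 1.
Proof.
elim: k x => [x|k IH x] /=.
  by under eq_bigr do rewrite -[_%:R]mulr1; rewrite sum_delta.
rewrite exchange_big /= -[RHS](stochP.2 x); apply: eq_bigr => z _.
by rewrite -mulr_sumr IH mulr1.
Qed.

Lemma kernel_pow_le1 k x y : kernel_pow P k x y <= 1.
Proof.
rewrite -(sum_kernel_pow k x) (bigD1 y)//= lerDl.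
by apply: sumr_ge0 => z _; exact: kernel_pow_ge0.
Qed.

Lemma kernel_pow_itv x y k : 0 <= kernel_pow P k x y <= 1.
Proof. by rewrite kernel_pow_ge0 kernel_pow_le1. Qed.

Lemma kernel_pow_norm x y k : `|kernel_pow P k x y| <= 1.
Proof. by rewrite ger0_norm ?kernel_pow_le1 ?kernel_pow_ge0. Qed.

Lemma heat_kernelE t x y :
  heat_kernel P t x y = expR (- t) * egf (fun k => kernel_pow P k x y) t.
Proof. by []. Qed.

Lemma egf_kernel_powS t x y : egf (fun k => kernel_pow P k.+1 x y) t =
  expR t * \sum_z P x z * heat_kernel P t z y.
Proof.
rewrite /= egf_sum; last by move=> z k; exact: kernel_pow_norm.
rewrite mulr_sumr; apply: eq_bigr => z _.
by rewrite heat_kernelE mulrCA; congr (_ * _); rewrite mulrA -expRD subrr expR0 mul1r.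
Qed.

Lemma heat_kernel0 x y : heat_kernel P 0 x y = (x == y)%:R.
Proof. by rewrite heat_kernelE egf0 oppr0 expR0 mul1r. Qed.

Lemma heat_kernel_ge0 t x y : 0 <= t -> 0 <= heat_kernel P t x y.
Proof.
by move=> t0; rewrite mulr_ge0 ?expR_ge0// egf_ge0// => k; exact: kernel_pow_itv.
Qed.

(** [P] commutes with its powers, hence with the semigroup. This turns the backward equation into
    the forward one. *)
Lemma sum_kernel_heat t x y :
  \sum_z P x z * heat_kernel P t z y = \sum_z heat_kernel P t x z * P z y.
Proof.
have expK u : u = expR (- t) * (expR t * u).
  by rewrite mulrA -expRD addNr expR0 mul1r.
rewrite [LHS]expK -egf_kernel_powS.
transitivity (expR (- t) * \sum_z P z y * egf (fun k => kernel_pow P k x z) t).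
  congr (_ * _); rewrite -egf_sum; last by move=> z k; exact: kernel_pow_norm.
  congr (egf _ t); apply/funext => k; rewrite kernel_powSr.
  by apply: eq_bigr => z _; rewrite mulrC.
by rewrite mulr_sumr; apply: eq_bigr => z _; rewrite mulrCA mulrC heat_kernelE.
Qed.

Lemma is_derive_heat_kernel t x y : is_derive t (1 : R)
  (fun u => heat_kernel P u x y)
  (\sum_z P x z * heat_kernel P t z y - heat_kernel P t x y).
Proof.
have := @is_deriveM R R (fun u => expR (- u)) (egf (fun k => kernel_pow P k x y))
  t 1 _ _ _ (@is_derive_egf R _ t (kernel_pow_norm x y)).
move=> /(_ (- expR (- t))).
rewrite egf_kernel_powS.
have -> : (\sum_z P x z * heat_kernel P t z y - heat_kernel P t x y) =
  expR (- t) *: (expR t * \sum_z P x z * heat_kernel P t z y) +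
   egf (fun k : nat => kernel_pow P k x y) t *: (- expR (- t)).
  by rewrite /GRing.scale /= mulrA -expRD addNr expR0 mul1r heat_kernelE mulrN [in RHS]mulrC.
apply.
have := @is_derive1_comp R expR -%R t (expR (- t)) (-1) _ _.
by rewrite mulrN1; apply; exact: is_deriveNid.
Qed.

Lemma is_derive_heat_kernelr t x y : is_derive t (1 : R)
  (fun u => heat_kernel P u x y)
  (\sum_z heat_kernel P t x z * P z y - heat_kernel P t x y).
Proof. by rewrite -sum_kernel_heat; exact: is_derive_heat_kernel. Qed.

(** By the forward equation the total mass has derivative zero. *)
Lemma sum_heat_kernel t x : \sum_y heat_kernel P t x y = 1.
Proof.
have -> : 1 = \sum_y heat_kernel P 0 x y.
  under eq_bigr do rewrite heat_kernel0 -[_%:R]mulr1.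
  by rewrite sum_delta.
apply: (@is_derive_0_is_cst R (fun u => \sum_y heat_kernel P u x y)) => u.
have := @is_derive_fsum R X (fun y u => heat_kernel P u x y) _ u
  (fun y => is_derive_heat_kernelr u x y).
rewrite big_split /= exchange_big /= sumrN.
rewrite (eq_bigr (fun z => heat_kernel P u x z)) ?subrr// => z _.
by rewrite -mulr_sumr stochP.2 mulr1.
Qed.

Lemma heat_kernel_sym t x y : symmetric_kernel P ->
  heat_kernel P t x y = heat_kernel P t y x.
Proof.
move=> symP; rewrite !heat_kernelE; congr (_ * egf _ _); apply/funext => k.
elim: k x y => [x y|k IH x y]; first by rewrite /= eq_sym.
by rewrite kernel_powSr /=; apply: eq_bigr => z _; rewrite IH symP mulrC.
Qed.

Lemma is_derive_heat_kernelB t u x y : is_derive u (1 : R)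
  (fun r => heat_kernel P (t - r) x y)
  (heat_kernel P (t - u) x y - \sum_z P x z * heat_kernel P (t - u) z y).
Proof.
have h := @is_derive1_comp R (fun u => heat_kernel P u x y) (fun r => t - r) u _ (-1)
   (is_derive_heat_kernel (t - u) x y).
have := h _; rewrite mulrN1 opprB; apply.
rewrite -[X in is_derive _ _ _ X]add0r.
by apply: is_deriveD; exact: is_deriveNid.
Qed.

(** The right-hand side, with times [r] and [s + t - r], does not depend on [r]: the forward
    equation for the first factor cancels the backward equation for the second. *)
Lemma heat_kernelD s t x y :
  heat_kernel P (s + t) x y = \sum_z heat_kernel P s x z * heat_kernel P t z y.
Proof.
pose F r := \sum_z heat_kernel P r x z * heat_kernel P (s + t - r) z y.
have -> : heat_kernel P (s + t) x y = F 0.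
  by rewrite /F; under eq_bigr do rewrite heat_kernel0; rewrite sum_delta subr0.
have -> : \sum_z heat_kernel P s x z * heat_kernel P t z y = F s.
  by rewrite /F; under [RHS]eq_bigr do rewrite addrAC subrr add0r.
apply: is_derive_0_is_cst => u.
pose v := s + t - u.
have <- : \sum_z (heat_kernel P u x z *
      (heat_kernel P v z y - \sum_w P z w * heat_kernel P v w y) +
    heat_kernel P v z y *
      (\sum_w heat_kernel P u x w * P w z - heat_kernel P u x z)) = 0.
  under eq_bigr do rewrite [X in _ + X]mulrC mulrBl mulrBr addrC.
  under eq_bigr do rewrite addrA addrNK.
  rewrite big_split /= sumrN; apply/eqP; rewrite subr_eq0; apply/eqP.
  under eq_bigr do rewrite mulr_suml.
  under [RHS]eq_bigr do rewrite mulr_sumr.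
  rewrite exchange_big /=; apply: eq_bigr => z _; apply: eq_bigr => w _.
  by rewrite -mulrA.
apply: (@is_derive_fsum R X
  (fun z r => heat_kernel P r x z * heat_kernel P (s + t - r) z y)) => z.
exact: (@is_deriveM R R _ _ u 1 _ _ (is_derive_heat_kernelr u x z)
              (is_derive_heat_kernelB (s + t) u z y)).
Qed.

End HeatKernel.

Lemma le_increment (R : realType) (F dF : R -> R) (t M : R) : 0 <= t ->
  (forall u, is_derive u (1 : R) F (dF u)) ->
  (forall u, 0 <= u <= t -> dF u <= M) -> F t - F 0 <= t * M.
Proof.
move=> t0 dFP dFM.
have cF : {within `[0, t], continuous F}%classic.
  apply: continuous_subspaceT => u.
  by apply: differentiable_continuous; apply/derivable1_diffP; case: (dFP u).
have [c] := @MVT_segment R F dF 0 t t0 (fun u _ => dFP u) cF.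
rewrite in_itv /= => c0t ->; rewrite subr0 mulrC ler_wpM2l//; exact: dFM.
Qed.

(** Nonnegativity of the variance of [f] under the weights [w]. *)
Lemma sqr_mean_le (R : realType) (I : finType) (w f : I -> R) :
  (forall i, 0 <= w i) -> \sum_i w i = 1 ->
  (\sum_i w i * f i) ^+ 2 <= \sum_i w i * f i ^+ 2.
Proof.
move=> w0 w1; set m := \sum_i w i * f i.
have : 0 <= \sum_i w i * (f i - m) ^+ 2.
  by apply: sumr_ge0 => i _; rewrite mulr_ge0 ?sqr_ge0.
rewrite (eq_bigr (fun i => w i * f i ^+ 2 - (2 * m) * (w i * f i) + m ^+ 2 * w i)); last first.
  by move=> i _; ring.
rewrite !big_split /= sumrN -!mulr_sumr w1 -/m; nra.
Qed.

(** * Dirichlet form and L2 decay for symmetric kernels *)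

Section SymmetricChain.
Variables (R : realType) (X : finType) (P : X -> X -> R).
Hypotheses (stochP : stochastic P) (symP : symmetric_kernel P).

Lemma carre_du_champE (f : X -> R) x : 2 * carre_du_champ P f x =
  \sum_y P x y * f y ^+ 2 - 2 * f x * \sum_y P x y * f y + f x ^+ 2.
Proof.
rewrite /carre_du_champ mulrA mulfV ?pnatr_eq0// mul1r.
rewrite (eq_bigr (fun y => P x y * f y ^+ 2 - 2 * f x * (P x y * f y) + f x ^+ 2 * P x y)); last first.
  by move=> y _; ring.
by rewrite !big_split /= sumrN -!mulr_sumr stochP.2 mulr1.
Qed.

(** Plain sums are used instead of expectations: a symmetric kernel is reversible for the counting
    measure, and the factor [1 / N] is dealt with once, in [poincare_uniform]. *)
Lemma sum_carre_du_champ (f : X -> R) : \sum_x carre_du_champ P f x =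
  \sum_x f x * (f x - \sum_y P x y * f y).
Proof.
apply: (@mulfI _ 2); first by rewrite pnatr_eq0.
rewrite mulr_sumr; under eq_bigr do rewrite carre_du_champE.
rewrite !big_split /= exchange_big /=.
have -> : \sum_y \sum_x P x y * f y ^+ 2 = \sum_y f y ^+ 2.
  apply: eq_bigr => y _; rewrite -mulr_suml.
  by under eq_bigr do rewrite symP; rewrite stochP.2 mul1r.
rewrite mulr_sumr -!big_split /=; apply: eq_bigr => x _; ring.
Qed.

Lemma carre_du_champ_ge0 (f : X -> R) x : 0 <= carre_du_champ P f x.
Proof.
rewrite mulr_ge0// sumr_ge0// => y _.
by rewrite mulr_ge0 ?sqr_ge0// stochP.1.
Qed.

Lemma sum_heat_kernel_col t y : \sum_x heat_kernel P t x y = 1.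
Proof.
rewrite -(sum_heat_kernel stochP t y); apply: eq_bigr => x _.
exact: heat_kernel_sym.
Qed.

Lemma is_derive_heat t (f : X -> R) x : is_derive t (1 : R)
  (fun u => \sum_y heat_kernel P u x y * f y)
  (\sum_z P x z * (\sum_y heat_kernel P t z y * f y) - \sum_y heat_kernel P t x y * f y).
Proof.
have <- : \sum_y (f y *: (\sum_z P x z * heat_kernel P t z y - heat_kernel P t x y)) =
  \sum_z P x z * (\sum_y heat_kernel P t z y * f y) - \sum_y heat_kernel P t x y * f y.
  rewrite /GRing.scale /=; under eq_bigr do rewrite mulrBr.
  rewrite big_split /= sumrN; congr (_ - _); last first.
    by apply: eq_bigr => y _; rewrite [LHS]mulrC.
  under eq_bigr do rewrite mulr_sumr.
  under [RHS]eq_bigr do rewrite mulr_sumr.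
  rewrite exchange_big /=; apply: eq_bigr => z _; apply: eq_bigr => y _.
  by rewrite [LHS]mulrC -mulrA.
apply: (@is_derive_fsum R X (fun y u => heat_kernel P u x y * f y)) => y.
rewrite (_ : (fun _ => _) = f y *: (fun u => heat_kernel P u x y)); last first.
  by apply/funext => u; rewrite [LHS]mulrC.
by apply: is_deriveZ; exact: is_derive_heat_kernel.
Qed.

(** Gronwall: the squared norm of [P_s f] has derivative [-2] times the Dirichlet form and [P_s f]
    stays centred, so [exp (2 s / r)] times that squared norm is nonincreasing. *)
Lemma heat_l2_decay (r t : R) (f : X -> R) : 0 < r -> 0 <= t ->
  (forall g : X -> R, \sum_x g x = 0 ->
     \sum_x g x ^+ 2 <= r * \sum_x carre_du_champ P g x) ->
  \sum_x f x = 0 ->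
  \sum_x (\sum_y heat_kernel P t x y * f y) ^+ 2 <=
    expR (- (2 * t / r)) * \sum_x f x ^+ 2.
Proof.
move=> r0 t0 poin f0.
pose u t x := \sum_y heat_kernel P t x y * f y.
have u0 s : \sum_x u s x = 0.
  rewrite /u exchange_big /= -[RHS]f0; apply: eq_bigr => y _.
  by rewrite -mulr_suml sum_heat_kernel_col mul1r.
pose F s := expR (2 / r * s) * \sum_x u s x ^+ 2.
pose dF s := expR (2 / r * s) * (2 / r * \sum_x u s x ^+ 2 - 2 * \sum_x carre_du_champ P (u s) x).
have dFP s : is_derive s (1 : R) F (dF s).
  have dsq : is_derive s (1:R) (fun s => \sum_x u s x ^+ 2)
      (- 2 * \sum_x carre_du_champ P (u s) x).
    rewrite sum_carre_du_champ mulr_sumr.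
    apply: (@is_derive_fsum R X (fun x s => u s x ^+ 2)) => x.
    have h := is_derive_heat s f x.
    apply: is_derive_eq (is_deriveM h h) _.
    by rewrite /GRing.scale /= -/(u s x); ring.
  have dexp : is_derive s (1:R) (fun s => expR (2 / r * s)) (expR (2 / r * s) * (2 / r)).
    have := @is_derive1_comp R expR (fun s => 2 / r * s) s (expR (2 / r * s)) (2 / r) _.
    apply; rewrite -[X in is_derive _ _ _ X]mulr1.
    by apply: is_deriveZ.
  have h := @is_deriveM R R _ _ s 1 _ _ dexp dsq.
  by apply: is_derive_eq h _; rewrite /GRing.scale /= /dF; ring.
have := @le_increment R F dF t 0 t0 dFP _; rewrite mulr0 subr_le0 => dec.
have {dec} : F t <= F 0.
  apply: dec => s _; rewrite /dF pmulr_rle0 ?expR_gt0// subr_le0.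
  rewrite -mulrA ler_pM2l// mulrC ler_pdivrMr// mulrC; exact: poin.
rewrite /F mulr0 expR0 mul1r => h.
have -> : \sum_x f x ^+ 2 = \sum_x u 0 x ^+ 2.
  apply: eq_bigr => x _; rewrite /u; congr (_ ^+ 2).
  by under [RHS]eq_bigr do rewrite heat_kernel0; rewrite sum_delta.
by rewrite expRN -ler_pdivrMl ?invr_gt0 ?expR_gt0// invrK mulrAC.
Qed.

End SymmetricChain.

(** * The heat kernel of a Cayley graph *)

Lemma egf_le (R : realType) (a : nat -> R) (t c M : R) :
  (forall k, `|a k| <= 1) ->
  (forall n, c * \sum_(0 <= k < n) a k * t ^+ k / k`!%:R <= M) ->
  c * egf a t <= M.
Proof.
move=> a1 h.
have cv : ((fun n => c * series (fun k : nat => a k * t ^+ k / k`!%:R) n) @ \oo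
    --> c * egf a t)%classic by apply: cvgMl_tmp; exact: is_cvg_egf.
rewrite -(cvg_lim _ cv)//; apply: limr_le; first by apply/cvg_ex; eexists; exact: cv.
by near=> n; exact: h.
Unshelve. all: by end_near. Qed.

(** In a finite group every element is a sum of generators without inverses, so no case [x - s] is
    needed. *)
Lemma gen_zmod_ind (X : finZmodType) (S : {set X}) (Q : X -> Prop) :
  <<S>>%g = [set: X] -> Q 0 -> (forall x s, s \in S -> Q x -> Q (x + s)) ->
  forall x, Q x.
Proof.
move=> gS Q0 QS x.
have /gen_prodgP[n [c cS ->]] : x \in <<S>>%g by rewrite gS inE.
elim: n c cS => [|n IH] c cS; first by rewrite big_ord0.
rewrite big_ord_recr /=; apply: QS; first exact: cS.
by apply: IH => i; exact: cS.
Qed.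

Section CayleyWalk.
Variables (R : realType) (X : finZmodType) (S : {set X}).
Hypotheses (S0 : (0 < #|S|)%N) (S_sym : -%R @: S = S).
Let P := @cayley_walk R X S.
Let d : R := #|S|%:R.

Let d_gt0 : 0 < d. Proof. by rewrite ltr0n. Qed.

Lemma cayley_walkE x y : P x y = d^-1 * (y - x \in S)%:R.
Proof.
rewrite /P /cayley_walk; congr (_ * _).
have [yS|yS] := boolP (y - x \in S).
  rewrite (bigD1 (y - x))//= subrKC eqxx big1 ?addr0// => z /andP[_ zx].
  by rewrite addrC -subr_eq eq_sym (negbTE zx).
rewrite big1// => z zS; rewrite addrC -subr_eq; case: eqP => // yxz.
by rewrite yxz zS in yS.
Qed.

Lemma sum_cayley_walk (f : X -> R) x :
  \sum_y P x y * f y = d^-1 * \sum_(s in S) f (x + s).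
Proof.
rewrite (reindex_inj (addrI x)) mulr_sumr [RHS]big_mkcond /=.
apply: eq_bigr => s _; rewrite cayley_walkE addrC addKr.
by case: (s \in S); rewrite ?mulr1// mulr0 mul0r.
Qed.

Lemma cayley_stochastic : stochastic P.
Proof.
split=> [x y|x]; first by rewrite cayley_walkE mulr_ge0// invr_ge0 ltW.
under eq_bigr do rewrite -[P _ _]mulr1.
by rewrite sum_cayley_walk sumr_const mulVf// gt_eqF.
Qed.

Lemma opp_memS x : (- x \in S) = (x \in S).
Proof. by rewrite -{1}S_sym mem_imset ?inE//; exact: oppr_inj. Qed.

Lemma cayley_symmetric : symmetric_kernel P.
Proof. by move=> x y; rewrite !cayley_walkE -opp_memS opprB. Qed.

Lemma kernel_pow_shift k x y z :
  kernel_pow P k (x + z) (y + z) = kernel_pow P k x y.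
Proof.
elim: k x y => [x y|k IH x y] /=; first by rewrite (inj_eq (addIr z)).
rewrite (reindex_inj (addIr z)); apply: eq_bigr => w _; rewrite IH.
by rewrite !cayley_walkE opprD addrACA subrr addr0.
Qed.

Lemma heat_kernel_shift t x y z :
  heat_kernel P t (x + z) (y + z) = heat_kernel P t x y.
Proof.
by rewrite !heat_kernelE; congr (_ * egf _ _); apply/funext => k; rewrite kernel_pow_shift.
Qed.

Lemma carre_du_champ_cayley (f : X -> R) x :
  2 * carre_du_champ P f x = d^-1 * \sum_(s in S) (f (x + s) - f x) ^+ 2.
Proof. by rewrite /carre_du_champ mulrA mulfV ?pnatr_eq0// mul1r sum_cayley_walk. Qed.

(* Translations commute with the semigroup, so [Gamma (P_t f) <= P_t (Gamma f)]
   reduces to Jensen's inequality: this is where commutativity enters. *)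
Lemma carre_du_champ_heat t (f : X -> R) x : 0 <= t ->
  carre_du_champ P (fun x => \sum_y heat_kernel P t x y * f y) x <=
  \sum_y heat_kernel P t x y * carre_du_champ P f y.
Proof.
move=> t0; rewrite -(@ler_pM2l _ 2)// carre_du_champ_cayley.
rewrite [leRHS]mulr_sumr; under [leRHS]eq_bigr do rewrite mulrCA carre_du_champ_cayley.
under [leRHS]eq_bigr do rewrite mulrCA mulr_sumr.
rewrite -mulr_sumr ler_pM2l ?invr_gt0// exchange_big /=.
apply: ler_sum => s _.
have -> : \sum_y heat_kernel P t (x + s) y * f y = \sum_y heat_kernel P t x y * f (y + s).
  by rewrite (reindex_inj (addIr s)); apply: eq_bigr => y _; rewrite heat_kernel_shift.
rewrite -sumrB (eq_bigr (fun y => heat_kernel P t x y * (f (y + s) - f y))); last first.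
  by move=> y _; rewrite mulrBr.
apply: sqr_mean_le => [y|]; first exact: heat_kernel_ge0 cayley_stochastic _ _ _ t0.
exact: sum_heat_kernel cayley_stochastic _ _.
Qed.

(** [F r = P_r ((P_(t - r) f) ^ 2)] interpolates between the two terms on the left. Its derivative
    [2 P_r (Gamma (P_(t - r) f))] is at most [2 P_t (Gamma f)] by [carre_du_champ_heat] and the
    semigroup property. *)
Lemma local_poincare t (f : X -> R) x : 0 <= t ->
  \sum_y heat_kernel P t x y * f y ^+ 2 - (\sum_y heat_kernel P t x y * f y) ^+ 2 <=
  2 * t * \sum_y heat_kernel P t x y * carre_du_champ P f y.
Proof.
move=> t0; have stP := cayley_stochastic.
pose u r z := \sum_y heat_kernel P r z y * f y.
pose F r := \sum_z heat_kernel P r x z * u (t - r) z ^+ 2.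
pose dF r := \sum_z heat_kernel P r x z * (2 * carre_du_champ P (u (t - r)) z).
have dFP r : is_derive r (1 : R) F (dF r).
  have du z : is_derive r (1 : R) (fun r => u (t - r) z)
      (u (t - r) z - \sum_w P z w * u (t - r) w).
    have := @is_derive1_comp R (fun r => u r z) (fun r => t - r) r _ (-1)
      (is_derive_heat stP (t - r) f z) _.
    rewrite mulrN1 opprB; apply.
    by rewrite -[X in is_derive _ _ _ X]add0r; apply: is_deriveD; exact: is_deriveNid.
  have -> : dF r = \sum_z (heat_kernel P r x z *
        (2 * u (t - r) z * (u (t - r) z - \sum_w P z w * u (t - r) w)) +
      u (t - r) z ^+ 2 * (\sum_w heat_kernel P r x w * P w z - heat_kernel P r x z)).
    rewrite /dF; set v := u (t - r).
    under eq_bigr do rewrite carre_du_champE//.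
    rewrite [RHS]big_split /=.
    have -> : \sum_z v z ^+ 2 * (\sum_w heat_kernel P r x w * P w z - heat_kernel P r x z) =
        \sum_z heat_kernel P r x z * (\sum_w P z w * v w ^+ 2 - v z ^+ 2).
      under eq_bigr do rewrite mulrBr; under [RHS]eq_bigr do rewrite mulrBr.
      rewrite !big_split /= !sumrN; congr (_ - _); last first.
        by apply: eq_bigr => z _; rewrite [LHS]mulrC.
      under eq_bigr do rewrite mulr_sumr; under [RHS]eq_bigr do rewrite mulr_sumr.
      rewrite exchange_big /=; apply: eq_bigr => z _; apply: eq_bigr => w _.
      by rewrite [LHS]mulrC -mulrA.
    rewrite -big_split /=; apply: eq_bigr => z _; rewrite -mulrDr; congr (_ * _).
    ring.
  apply: (@is_derive_fsum R X (fun z r => heat_kernel P r x z * u (t - r) z ^+ 2)) => z.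
  have h := @is_deriveM R R _ _ r 1 _ _ (is_derive_heat_kernelr stP r x z)
     (@is_deriveM R R _ _ r 1 _ _ (du z) (du z)).
  apply: is_derive_eq h _; rewrite /GRing.scale /=; congr (_ * _ + _); ring.
have := @le_increment R F dF t (2 * \sum_y heat_kernel P t x y * carre_du_champ P f y) t0 dFP _.
rewrite [t * _]mulrA [t * 2]mulrC.
have -> : F t = \sum_y heat_kernel P t x y * f y ^+ 2.
  apply: eq_bigr => z _; rewrite /u subrr.
  by under eq_bigr do rewrite heat_kernel0; rewrite sum_delta.
have -> : F 0 = (\sum_y heat_kernel P t x y * f y) ^+ 2.
  by rewrite /F; under eq_bigr do rewrite heat_kernel0; rewrite sum_delta subr0.
apply=> r /andP[r0 rt].
have tr0 : 0 <= t - r by rewrite subr_ge0.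
rewrite /dF mulr_sumr; under eq_bigr do rewrite mulrCA.
rewrite -mulr_sumr -mulr_sumr ler_pM2l//.
have -> : \sum_y heat_kernel P t x y * carre_du_champ P f y =
   \sum_z heat_kernel P r x z * \sum_y heat_kernel P (t - r) z y * carre_du_champ P f y.
  rewrite -[in LHS](subrKC r t).
  under eq_bigr do rewrite heat_kernelD// mulr_suml.
  rewrite exchange_big /=; apply: eq_bigr => z _; rewrite mulr_sumr.
  by apply: eq_bigr => y _; rewrite -[LHS]mulrA.
apply: ler_sum => z _; apply: ler_wpM2l; first exact: heat_kernel_ge0.
exact: carre_du_champ_heat.
Qed.

(* Termwise, [1 / (k + 1) >= 2 c - c ^ 2 (k + 1)]; the optimal [c] gives
   [p(y) / p(y + s) <= d * (1 / t + (p P)(y) / p(y))] for the law [p] at time [t]. *)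
Lemma heat_kernel_step t x y s c : 0 <= t -> s \in S ->
  t / d * (2 * c * heat_kernel P t x y - c ^+ 2 *
    (heat_kernel P t x y + t * \sum_z heat_kernel P t x z * P z y))
  <= heat_kernel P t x (y + s).
Proof.
move=> t0 sS; have stP := cayley_stochastic.
rewrite -sum_kernel_heat// -(ler_pM2l (expR_gt0 t)).
set a := fun k => kernel_pow P k x y; set b := fun k => kernel_pow P k x (y + s).
have expK z : expR t * heat_kernel P t x z = egf (fun k => kernel_pow P k x z) t.
  by rewrite heat_kernelE mulrA -expRD subrr expR0 mul1r.
have -> : expR t * (t / d * (2 * c * heat_kernel P t x y - c ^+ 2 *
    (heat_kernel P t x y + t * \sum_z P x z * heat_kernel P t z y))) =
  t / d * (2 * c - c ^+ 2) * egf a t - t / d * c ^+ 2 * (t * egf (fun k => a k.+1) t).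
  by rewrite egf_kernel_powS// -(expK y); ring.
rewrite expK -/b lerBlDr; apply: egf_le; first exact: kernel_pow_norm.
move=> n; rewrite -lerBlDr.
have td0 : 0 <= t / d by rewrite divr_ge0// ltW.
have mom := egf_moment_le n (kernel_pow_itv stP x y) t0.
(* One more term than for [y]: [k] jumps to [y] are compared with [k + 1] jumps to [y + s], and the
   term without jumps is dropped. *)
have par := egf_partial_sum_le n.+1 (kernel_pow_itv stP x (y + s)) t0.
have tc0 : 0 <= t / d * c ^+ 2 by rewrite mulr_ge0 ?sqr_ge0.
apply: le_trans par; rewrite big_nat_recl//=.
apply: (@le_trans _ _ (t / d * (\sum_(0 <= k < n) (2 * c - c ^+ 2 - c ^+ 2 * k%:R) *
    (a k * t ^+ k / k`!%:R)))).
  have -> : \sum_(0 <= k < n) (2 * c - c ^+ 2 - c ^+ 2 * k%:R) * (a k * t ^+ k / k`!%:R) =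
    (2 * c - c ^+ 2) * \sum_(0 <= k < n) a k * t ^+ k / k`!%:R -
    c ^+ 2 * \sum_(0 <= k < n) k%:R * (a k * t ^+ k / k`!%:R).
    rewrite !mulr_sumr -sumrB; apply: eq_bigr => k _; ring.
  have := ler_wpM2l tc0 mom; rewrite -/a; lra.
rewrite mulr_sumr; apply: (@le_trans _ _ (\sum_(0 <= k < n) b k.+1 * t ^+ k.+1 / k.+1`!%:R));
  last by rewrite lerDr// ?mulr_ge0// ?ler0n// invr_ge0 ler0n.
apply: ler_sum => k _.
(* Keep only the paths whose last jump is [s], of probability [1 / d]. *)
have abk : a k / d <= b k.+1.
  rewrite /b kernel_powSr (bigD1 y)//=; apply: ler_wpDr.
    by apply: sumr_ge0 => z _; rewrite mulr_ge0 ?kernel_pow_ge0//; exact: stP.1.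
  by rewrite cayley_walkE addrC addKr sS mulr1.
have k1 : 0 < k.+1%:R :> R by rewrite ltr0n.
have w0 : 0 <= t ^+ k.+1 / k.+1`!%:R by rewrite divr_ge0 ?exprn_ge0.
rewrite -[leRHS]mulrA; apply: le_trans (ler_wpM2r w0 abk).
have ad0 : 0 <= a k / d * (t ^+ k.+1 / k`!%:R).
  by rewrite mulr_ge0// ?divr_ge0 ?kernel_pow_ge0 ?exprn_ge0// ltW.
rewrite [leLHS](_ : _ = (a k / d * (t ^+ k.+1 / k`!%:R)) * (2 * c - c ^+ 2 * k.+1%:R)); last first.
  by rewrite (exprS t) -[k.+1%:R]nat1r; ring.
rewrite [leRHS](_ : _ = (a k / d * (t ^+ k.+1 / k`!%:R)) * k.+1%:R^-1); last first.
  by rewrite factS natrM invfM; ring.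
apply: ler_wpM2l => //; rewrite -(ler_pM2r k1) mulVf ?gt_eqF//.
have := sqr_ge0 (c * k.+1%:R - 1); nra.
Qed.

Lemma heat_kernel_gt0 t x y : <<S>>%g = [set: X] -> 0 < t -> 0 < heat_kernel P t x y.
Proof.
move=> gS t0; have stP := cayley_stochastic; have t0' := ltW t0.
rewrite -[y](subrKC x); move: (y - x) => z {y}.
move: z; apply: (gen_zmod_ind gS) => [|z s sS pz].
  rewrite addr0 heat_kernelE mulr_gt0 ?expR_gt0//.
  have := egf_partial_sum_le 1 (kernel_pow_itv stP x x) t0'.
  rewrite big_nat1 /= eqxx expr0 fact0 mulr1 divr1; exact: lt_le_trans.
set p := heat_kernel P t x (x + z) in pz.
set q := p + t * \sum_w heat_kernel P t x w * P w (x + z).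
have q0 : 0 < q.
  rewrite ltr_wpDr// mulr_ge0// sumr_ge0// => w _.
  by rewrite mulr_ge0 ?heat_kernel_ge0//; exact: stP.1.
(* [c = p / q] maximises [2 c p - c ^ 2 q], with value [p ^ 2 / q]. *)
have := heat_kernel_step x (x + z) (p / q) t0' sS; rewrite -/p -/q addrA.
apply: lt_le_trans; rewrite mulr_gt0 ?divr_gt0//.
rewrite (_ : _ - _ = p ^+ 2 / q) ?divr_gt0 ?exprn_gt0//.
by field; rewrite gt_eqF.
Qed.

End CayleyWalk.

(** * Varentropy and mixing *)

(** Square [exp v >= v] at [v = ln r / 2]. *)
Lemma sqr_ln_le (R : realType) (r : R) : 1 <= r -> ln r ^+ 2 <= 4 * r.
Proof.
move=> r1; have r0 : 0 < r by rewrite (lt_le_trans ltr01).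
have l0 : 0 <= ln r by rewrite ln_ge0.
have e : expR (ln r / 2) ^+ 2 = r.
  by rewrite expr2 -expRD -splitr lnK.
have := expR_ge1Dx (ln r / 2); move: e; set w := expR _ => e h.
have : 0 <= (w - ln r / 2) * (w + ln r / 2) by apply: mulr_ge0; lra.
by nra.
Qed.

(** The bound is linear in [q / p] and [b], whose means are explicit in the application. If [q < p],
    then [ln p - ln q <= ln d + ln b], and [(ln d + ln b) ^ 2 <= 2 ln d ^ 2 + 2 ln b ^ 2]; for
    [b < 1] the term [ln b] is negative and is dropped. *)
Lemma sqr_ln_ratio_le (R : realType) (p q b d : R) : 0 < p -> 0 < q -> 0 < b -> 1 <= d ->
  p <= d * b * q -> (ln q - ln p) ^+ 2 <= 4 * (q / p) + 2 * ln d ^+ 2 + 8 * b.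
Proof.
move=> p0 q0 b0 d1 pq.
have d0 : 0 < d by rewrite (lt_le_trans ltr01).
have qp0 : 0 < q / p by rewrite divr_gt0.
have ld := sqr_ge0 (ln d).
have [pleq|qltp] := leP p q.
  have := @sqr_ln_le R (q / p); rewrite ler_pdivlMr// mul1r => /(_ pleq).
  by rewrite ln_div ?posrE//; nra.
have r1 : ln p - ln q <= ln d + ln b.
  by rewrite -ln_div ?posrE// -lnM ?posrE// ler_ln ?posrE ?divr_gt0 ?mulr_gt0// ler_pdivrMr.
have r0 : 0 <= ln p - ln q by rewrite subr_ge0 ler_ln ?posrE// ltW.
have ld0 : 0 <= ln d by rewrite ln_ge0.
rewrite -sqrrN opprB.
have [b1|b1] := leP 1 b.
  have := sqr_ln_le b1; have lb0 : 0 <= ln b by rewrite ln_ge0.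
  by have := sqr_ge0 (ln d - ln b); nra.
have lb0 : ln b <= 0 by rewrite ln_le0 ?ltW.
by nra.
Qed.

Definition varentropy (R : realType) (X : finType) (p : X -> R) : R :=
  \sum_x p x * ln (p x) ^+ 2 - (\sum_x p x * ln (p x)) ^+ 2.

(* In the local Poincare inequality for [ln p], the increments with
   [p (y + s) >= p y] are controlled because the [p]-mean of [p (y + s) / p y]
   is [1], and the others by [heat_kernel_step], because [p P] has mass [1]. *)
Lemma varentropy_le (R : realType) (X : finZmodType) (S : {set X}) (t : R) (x : X) :
  (0 < #|S|)%N -> -%R @: S = S -> <<S>>%g = [set: X] -> 1 <= t ->
  varentropy (heat_kernel (@cayley_walk R X S) t x) <=
    t * (20 + 2 * ln (#|S|%:R : R) ^+ 2).
Proof.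
move=> S0 S_sym gS t1; set P := cayley_walk R S; set p := heat_kernel P t x; set d : R := #|S|%:R.
have stP := cayley_stochastic R S0; have symP := cayley_symmetric R S_sym.
have t0 : 0 < t by rewrite (lt_le_trans ltr01).
have d0 : 0 < d by rewrite ltr0n.
have d1 : 1 <= d by rewrite ler1n.
have p0 y : 0 < p y by apply: heat_kernel_gt0.
have p1 : \sum_y p y = 1 by exact: sum_heat_kernel.
pose q y := \sum_z p z * P z y.
have q0 y : 0 <= q y.
  by apply: sumr_ge0 => z _; rewrite mulr_ge0 ?(ltW (p0 z))//; exact: stP.1.
have q1 : \sum_y q y = 1.
  rewrite exchange_big -[RHS]p1 /=; apply: eq_bigr => z _.
  by rewrite -mulr_sumr stP.2 mulr1.
apply: le_trans (local_poincare S0 (fun y => ln (p y)) x (ltW t0)) _.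
rewrite [2 * t]mulrC -mulrA ler_pM2l// mulr_sumr.
under eq_bigr => y _ do rewrite mulrCA carre_du_champ_cayley//.
under eq_bigr do rewrite mulrCA mulr_sumr.
rewrite -mulr_sumr exchange_big /= -/d.
rewrite ler_pdivrMl// [leRHS]mulrC mulr_natr -sumr_const.
apply: ler_sum => s sS.
(* This is [1 / t + q y / p y], the value given by the optimal [c] in [heat_kernel_step]. *)
pose b y := (p y + t * q y) / (t * p y).
have b0 y : 0 < b y.
  apply: divr_gt0; last exact: mulr_gt0.
  by apply: ltr_wpDr => //; rewrite mulr_ge0// ltW.
apply: (@le_trans _ _ (\sum_y (4 * p (y + s) + 2 * ln d ^+ 2 * p y + 8 * (t^-1 * p y + q y)))).
  apply: ler_sum => y _.
  have ratio : p y <= d * b y * p (y + s).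
    have := heat_kernel_step S0 x y (p y / (p y + t * q y)) (ltW t0) sS.
    rewrite -/p -/(q y) -/d.
    have py := p0 y; have w0 : 0 < p y + t * q y by rewrite ltr_wpDr// mulr_ge0// ltW.
    rewrite (_ : _ - _ = p y ^+ 2 / (p y + t * q y)); last first.
      by field; rewrite gt_eqF.
    move=> h; rewrite (_ : p y = d * b y * (t / d * (p y ^+ 2 / (p y + t * q y)))); last first.
      by rewrite /b; field; rewrite !gt_eqF.
    by rewrite ler_pM2l// mulr_gt0.
  have := sqr_ln_ratio_le (p0 y) (p0 (y + s)) (b0 y) d1 ratio.
  move=> /(ler_wpM2l (ltW (p0 y)))/le_trans; apply.
  rewrite le_eqVlt; apply/orP; left; apply/eqP.
  by rewrite /b; field; rewrite !gt_eqF.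
have lin (f g h k : X -> R) (c1 c2 c3 c4 : R) :
    \sum_y (c1 * f y + c2 * g y + c3 * (c4 * h y + k y)) =
    c1 * \sum_y f y + c2 * \sum_y g y + c3 * (c4 * \sum_y h y + \sum_y k y).
  by rewrite !big_split /= -!mulr_sumr big_split /= -mulr_sumr.
rewrite (lin (fun y => p (y + s)) p p q) q1 p1.
have -> : \sum_y p (y + s) = 1 by rewrite -[RHS]p1 [RHS](reindex_inj (addIr s)).
(* All masses being 1, the total is [4 + 2 ln d ^ 2 + 8 (1 / t + 1)], whence the constant 20. *)
have : t^-1 <= 1 by rewrite invf_le1.
by rewrite -/d; nra.
Qed.

(** * Total variation, concentration of [ln p] and truncation *)

Section TotalVariation.
Variables (R : realType) (X : finType).

Lemma le_tv_dist (mu nu : X -> R) (A : {set X}) :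
  `|\sum_(x in A) mu x - \sum_(x in A) nu x| <= tv_dist mu nu.
Proof. exact: (le_bigmax _ (fun A : {set X} => `|\sum_(x in A) mu x - \sum_(x in A) nu x|) A). Qed.

Lemma tv_dist_le (mu nu : X -> R) (M : R) : 0 <= M ->
  (forall A : {set X}, `|\sum_(x in A) mu x - \sum_(x in A) nu x| <= M) ->
  tv_dist mu nu <= M.
Proof. by move=> M0 h; apply: bigmax_le. Qed.

Lemma le_worst_tv (P : X -> X -> R) (pi : X -> R) t x :
  tv_dist (heat_kernel P t x) pi <= worst_tv P pi t.
Proof. exact: (le_bigmax _ (fun x => tv_dist (heat_kernel P t x) pi) x). Qed.

Lemma worst_tv_le (P : X -> X -> R) (pi : X -> R) t (M : R) : 0 <= M ->
  (forall x (A : {set X}),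
    `|\sum_(y in A) heat_kernel P t x y - \sum_(y in A) pi y| <= M) ->
  worst_tv P pi t <= M.
Proof. by move=> M0 h; apply: bigmax_le => // x _; exact: tv_dist_le. Qed.

End TotalVariation.

(* By Chebyshev's inequality, the set of the [x] with [ln (p x) >= D - sigma]
   has [p]-mass at least [1 - eps / 4], but at most [exp (sigma - D)] elements. *)
Lemma entropy_deficit_le (R : realType) (X : finType) (p : X -> R) (eps : R) :
  (forall x, 0 < p x) -> \sum_x p x = 1 -> 0 < eps < 1 ->
  let D := \sum_x p x * ln (p x) in
  let sigma := 2 * Num.sqrt ((varentropy p + 1) / eps) in
  [/\ \sum_(x | ~~ (ln (p x) <= D + sigma)) p x <= eps / 4
    & tv_dist p (fun=> #|X|%:R^-1) <= 1 - eps ->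
      ln (#|X|%:R : R) + D <= sigma + ln (2 / eps)].
Proof.
move=> p0 p1 /andP[e0 e1] D sigma; pose V := varentropy p.
have V0 : 0 <= V by rewrite subr_ge0; apply: sqr_mean_le => // x; exact: ltW.
(* The [+ 1] keeps [sigma] positive even when [V = 0]; [sigma ^ 2 = 4 (V + 1) / eps] is tuned so
   that Chebyshev gives [eps / 4]. *)
have V1 : 0 < V + 1 by rewrite ltr_wpDl.
have s2 : sigma ^+ 2 = 4 * (V + 1) / eps.
  rewrite /sigma -/V exprMn sqr_sqrtr; last by rewrite divr_ge0 ?(ltW V1) ?(ltW e0).
  by field; rewrite gt_eqF.
have s0 : 0 < sigma.
  by rewrite mulr_gt0// sqrtr_gt0 divr_gt0.
have VE : \sum_x p x * (ln (p x) - D) ^+ 2 = V.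
  rewrite (eq_bigr (fun x => p x * ln (p x) ^+ 2 - 2 * D * (p x * ln (p x)) + D ^+ 2 * p x)); last first.
    by move=> x _; ring.
  by rewrite !big_split /= sumrN -!mulr_sumr p1 -/D /V /varentropy -/D; ring.
have cheb (Q : pred X) : (forall x, Q x -> sigma ^+ 2 <= (ln (p x) - D) ^+ 2) ->
    \sum_(x | Q x) p x <= eps / 4.
  move=> hQ; rewrite -(@ler_pM2l _ (sigma ^+ 2)) ?exprn_gt0//.
  apply: (@le_trans _ _ V).
    rewrite -VE mulr_sumr [leRHS](bigID Q) /=; apply: ler_wpDr.
      by apply: sumr_ge0 => x _; rewrite mulr_ge0 ?sqr_ge0// ltW.
    by apply: ler_sum => x Qx; rewrite mulrC ler_pM2l// hQ.
  rewrite s2 (_ : _ * (eps / 4) = V + 1) ?lerDl//; field; rewrite gt_eqF//.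
split.
  by apply: cheb => x; rewrite -ltNge => h; nra.
move=> tvle; pose A := [set x | D - sigma <= ln (p x)].
have pAC : \sum_(x in ~: A) p x <= eps / 4.
  by apply: cheb => x; rewrite !inE -ltNge => h; nra.
have pA : \sum_(x in A) p x = 1 - \sum_(x in ~: A) p x.
  rewrite -p1 [in RHS](bigID (mem A)) /=.
  by rewrite [X in _ - X](eq_bigl (fun x => x \notin A)) ?addrK// => x; rewrite inE.
have N0 : 0 < (#|X|%:R : R).
  rewrite ltr0n lt0n; apply/negP => /eqP/card0_eq X0.
  by move: p1; rewrite big1 => [|x]; [move/eqP; rewrite eq_sym oner_eq0 | have := X0 x].
have cA : #|A|%:R <= expR (sigma - D).
  rewrite -[sigma - D]opprB expRN -[leRHS]mulr1 -ler_pdivrMl ?invr_gt0 ?expR_gt0// invrK.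
  rewrite mulr_natr -sumr_const (@le_trans _ _ (\sum_(x in A) p x))//.
    apply: ler_sum => x; rewrite inE => h.
    by rewrite -[leRHS]lnK ?posrE// ler_expR.
  by rewrite pA gerBl sumr_ge0// => x _; exact: ltW.
(* On [A] the distance is at least [1 - eps / 4 - #|A| / N], so [#|A| / N >= 3 eps / 4], of which
   [eps / 2] is kept. *)
have := le_trans (le_tv_dist p (fun=> #|X|%:R^-1) A) tvle.
rewrite sumr_const ler_norml => /andP[_]; rewrite pA -[_^-1 *+ _]mulr_natr.
have : #|A|%:R / #|X|%:R <= expR (sigma - D) / #|X|%:R by rewrite ler_pM2r ?invr_gt0.
rewrite [_^-1 * _]mulrC => h1 h2.
have h3 : eps / 2 <= expR (sigma - D) / #|X|%:R by lra.
have : ln (eps / 2) <= sigma - D - ln #|X|%:R.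
  rewrite -[sigma - D in leRHS]expRK -ln_div ?posrE ?expR_gt0//.
  by rewrite ler_ln ?posrE ?divr_gt0 ?expR_gt0.
by rewrite -[2 / eps]invf_div lnV ?posrE ?divr_gt0//; lra.
Qed.

(* The part of [p] on [B] has squared L2 norm at most [K], hence relaxes at rate
   [1 / r]; the rest costs at most [delta]. *)
Lemma truncated_mixing (R : realType) (X : finType) (P : X -> X -> R) (r t K delta eta : R)
    (p : X -> R) (B : pred X) (A : {set X}) :
  stochastic P -> symmetric_kernel P -> 0 < r -> 0 <= t ->
  (forall g : X -> R, \sum_x g x = 0 ->
     \sum_x g x ^+ 2 <= r * \sum_x carre_du_champ P g x) ->
  (forall x, 0 <= p x) -> \sum_x p x = 1 ->
  0 <= K -> (forall x, B x -> p x <= K) -> \sum_(x | ~~ B x) p x <= delta ->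
  0 <= eta -> #|X|%:R * K * expR (- (2 * t / r)) <= eta ^+ 2 ->
  `|\sum_(y in A) (\sum_z p z * heat_kernel P t z y) - \sum_(y in A) #|X|%:R^-1| <= eta + delta.
Proof.
move=> stP symP r0 t0 poin p0 p1 K0 pK pB eta0 hK.
set N : R := #|X|%:R.
have N0 : 0 < N.
  rewrite ltr0n lt0n; apply/negP => /eqP/card0_eq X0.
  by move: p1; rewrite big1 => [|x]; [move/eqP; rewrite eq_sym oner_eq0 | have := X0 x].
pose g x := if B x then p x else 0.
pose g' x := if B x then 0 else p x.
have pE x : p x = g x + g' x by rewrite /g /g'; case: ifP; rewrite ?addr0 ?add0r.
have g0 x : 0 <= g x by rewrite /g; case: ifP.
have g'0 x : 0 <= g' x by rewrite /g'; case: ifP.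
pose m' := \sum_x g' x; pose m := \sum_x g x.
have mm : m + m' = 1 by rewrite -p1 -big_split; apply: eq_bigr => x _.
have m'd : m' <= delta.
  apply: le_trans pB; rewrite [leRHS]big_mkcond /=.
  by apply: ler_sum => x _; rewrite /g'; case: (B x).
have m'0 : 0 <= m' by exact: sumr_ge0.
pose f x := g x - m / N.
have f0 : \sum_x f x = 0.
  by rewrite sumrB sumr_const -mulr_natr -/m -/N divfK ?subrr// gt_eqF.
have fK : \sum_x f x ^+ 2 <= K.
  have fE : \sum_x f x ^+ 2 = \sum_x g x ^+ 2 - m ^+ 2 / N.
    rewrite (eq_bigr (fun x => g x ^+ 2 - 2 * (m / N) * g x + (m / N) ^+ 2)); last first.
      by move=> x _; rewrite /f; ring.
    rewrite !big_split /= sumrN -mulr_sumr -/m sumr_const -[_ *+ _]mulr_natr -/N.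
    by field; rewrite gt_eqF.
  apply: (@le_trans _ _ (\sum_x g x ^+ 2)).
    by rewrite fE gerBl divr_ge0 ?sqr_ge0// ltW.
  apply: (@le_trans _ _ (\sum_x K * g x)).
    apply: ler_sum => x _; rewrite expr2 ler_wpM2r// /g; case: ifP => // Bx; exact: pK.
  by rewrite -mulr_sumr -/m ler_piMr//; lra.
pose u x := \sum_y heat_kernel P t x y * f y.
have l2 : (\sum_(y in A) u y) ^+ 2 <= eta ^+ 2.
  apply: le_trans hK.
  have l2 := heat_l2_decay stP symP r0 t0 poin f0.
  (* Cauchy-Schwarz, as Jensen for the uniform weights and [u] cut off outside [A]. *)
  have cs : (\sum_(y in A) u y) ^+ 2 <= N * \sum_y u y ^+ 2.
    have w0 (x : X) : 0 <= N^-1 by rewrite invr_ge0 ltW.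
    have w1 : \sum_(x : X) N^-1 = 1 by rewrite sumr_const -[_ *+ _]mulr_natr mulVf ?gt_eqF.
    have := @sqr_mean_le R X (fun=> N^-1) (fun y => if y \in A then u y else 0) w0 w1.
    rewrite -!mulr_sumr -big_mkcond exprMn expr2 -mulrA ler_pM2l ?invr_gt0//.
    rewrite ler_pdivrMl// => /le_trans; apply; rewrite ler_pM2l//.
    by apply: ler_sum => y _; case: ifP; rewrite // expr0n sqr_ge0.
  apply: (le_trans cs); rewrite -mulrA ler_pM2l// mulrC.
  apply: (le_trans l2); rewrite ler_wpM2l ?expR_ge0//.
have {}l2 : `|\sum_(y in A) u y| <= eta.
  by rewrite -(ler_pXn2r (n := 2))// ?nnegrE// real_normK ?num_real.
pose v y := \sum_z heat_kernel P t y z * g' z.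
have v0 y : 0 <= v y by apply: sumr_ge0 => z _; rewrite mulr_ge0// heat_kernel_ge0.
have vm : \sum_y v y = m'.
  rewrite exchange_big; apply: eq_bigr => z _ /=.
  by rewrite -mulr_suml sum_heat_kernel_col// mul1r.
have vA0 : 0 <= \sum_(y in A) v y by exact: sumr_ge0.
have vA : \sum_(y in A) v y <= m'.
  by rewrite -vm [leRHS](bigID (mem A)) /= lerDl sumr_ge0.
have AN : 0 <= #|A|%:R / N <= 1.
  by rewrite divr_ge0 ?(ltW N0)//= ler_pdivrMr// mul1r ler_nat max_card.
have E : \sum_(y in A) (\sum_z p z * heat_kernel P t z y) =
    \sum_(y in A) u y + \sum_(y in A) v y + m * (#|A|%:R / N).
  rewrite -big_split /= mulrCA -[#|A|%:R * _]mulrC mulr_natr -sumr_const -big_split /=.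
  apply: eq_bigr => y _; rewrite -big_split /=.
  transitivity (\sum_z (heat_kernel P t y z * f z + heat_kernel P t y z * g' z +
      heat_kernel P t y z * (m / N))).
    by apply: eq_bigr => z _; rewrite (heat_kernel_sym _ _ _ symP) pE /f; ring.
  by rewrite big_split /= -mulr_suml (sum_heat_kernel stP) mul1r.
rewrite E sumr_const -[N^-1 *+ _]mulr_natr [N^-1 * _]mulrC.
move: l2 AN; rewrite !ler_norml => /andP[l1 l2] /andP[AN0 AN1].
(* As [m = 1 - m'], the deviation is [u (A) + v (A) - m' * #|A| / N]. The last two quantities both
   lie in [[0, m']], so their difference costs [delta] once, not twice. *)
have : m' * (#|A|%:R / N) <= m' by rewrite ler_piMr.
have : 0 <= m' * (#|A|%:R / N) by rewrite mulr_ge0.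
rewrite (_ : m = 1 - m'); last by lra.
by move=> *; apply/andP; split; lra.
Qed.

(** * Equilibrium, relaxation time and volume bound *)

(** The difference of the two sides is half the sum of the [P x y * (g x + g y) ^ 2]: the spectrum
    of [P] lies above [-1]. *)
Lemma sum_carre_du_champ_le (R : realType) (X : finType) (P : X -> X -> R) (g : X -> R) :
  stochastic P -> symmetric_kernel P ->
  \sum_x carre_du_champ P g x <= 2 * \sum_x g x ^+ 2.
Proof.
move=> stP symP.
have : 0 <= \sum_x \sum_y P x y * (g x + g y) ^+ 2.
  by apply: sumr_ge0 => x _; apply: sumr_ge0 => y _; rewrite mulr_ge0 ?sqr_ge0// stP.1.
have -> : \sum_x \sum_y P x y * (g x + g y) ^+ 2 =
    \sum_x (2 * g x ^+ 2 + 2 * (\sum_y P x y * g y ^+ 2) - 2 * carre_du_champ P g x).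
  apply: eq_bigr => x _; rewrite carre_du_champE//.
  rewrite (eq_bigr (fun y => P x y * g y ^+ 2 + 2 * g x * (P x y * g y) +
    g x ^+ 2 * P x y)); last by move=> y _; ring.
  by rewrite !big_split /= -!mulr_sumr stP.2; lra.
have sq : \sum_x \sum_y P x y * g y ^+ 2 = \sum_y g y ^+ 2.
  rewrite exchange_big /=; apply: eq_bigr => y _; rewrite -mulr_suml.
  by under eq_bigr do rewrite symP; rewrite stP.2 mul1r.
by rewrite !big_split /= sumrN -!mulr_sumr sq; lra.
Qed.

Section CayleyEquilibrium.
Variables (R : realType) (X : finZmodType) (S : {set X}).
Hypotheses (S0 : (0 < #|S|)%N) (S_sym : -%R @: S = S) (S_gen : <<S>>%g = [set: X]).
Let P := @cayley_walk R X S.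
Let stP : stochastic P := @cayley_stochastic R X S S0.
Let symP : symmetric_kernel P := cayley_symmetric R S_sym.

Lemma sqr_increment_le (g : X -> R) x s : s \in S ->
  (g (x + s) - g x) ^+ 2 <= 2 * #|S|%:R * \sum_y carre_du_champ P g y.
Proof.
move=> sS; have d0 : 0 < (#|S|%:R : R) by rewrite ltr0n.
rewrite mulrAC mulr_sumr; under eq_bigr do rewrite carre_du_champ_cayley//.
rewrite -mulr_sumr mulrC mulVKf ?gt_eqF// (bigD1 x)//= (bigD1 s)//= -addrA lerDl.
rewrite addr_ge0// sumr_ge0// => [*|y _]; first exact: sqr_ge0.
by rewrite sumr_ge0// => *; exact: sqr_ge0.
Qed.

(** By symmetry of [P], an invariant [pi] is harmonic. Its Dirichlet form vanishes, hence so do its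
    increments along generators. *)
Lemma invariant_law_uniform (pi : X -> R) : invariant_law P pi ->
  pi = fun=> #|X|%:R^-1.
Proof.
move=> [[pi0 pi1] inv].
have E0 : \sum_x carre_du_champ P pi x = 0.
  rewrite sum_carre_du_champ// big1// => x _.
  under eq_bigr do rewrite symP mulrC.
  by rewrite inv subrr mulr0.
have cst x : pi x = pi 0.
  move: x; apply: (gen_zmod_ind S_gen) => // x s sS <-.
  have := sqr_increment_le pi x sS; rewrite E0 mulr0 => h.
  apply/eqP; rewrite -subr_eq0 -sqrf_eq0; apply/eqP.
  by apply: le_anti; rewrite h sqr_ge0.
apply/funext => x; rewrite cst.
move: pi1; rewrite (eq_bigr (fun=> pi 0)); last by move=> y _; exact: cst.
rewrite sumr_const -[_ *+ _]mulr_natr => h.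
by apply: (@mulIf _ #|X|%:R); rewrite ?h ?mulVf// pnatr_eq0 -lt0n; apply/card_gt0P; exists 0.
Qed.

Let N : R := #|X|%:R.
Let N0 : 0 < N. Proof. by rewrite ltr0n; apply/card_gt0P; exists 0. Qed.
Let piu : X -> R := fun=> N^-1.

Let mean_N (f : X -> R) : \sum_x piu x * f x = (\sum_x f x) / N.
Proof. by rewrite -mulr_sumr mulrC. Qed.

(** The factor [1 / N] cancels, and [Gamma] ignores additive constants. *)
Lemma poincare_uniform c :
  (forall f : X -> R, variance piu f <= c * expect piu (carre_du_champ P f)) <->
  (forall g : X -> R, \sum_x g x = 0 ->
     \sum_x g x ^+ 2 <= c * \sum_x carre_du_champ P g x).
Proof.
split=> [h g g0|h f].
  have := h g; rewrite /variance /expect !mean_N g0 mul0r.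
  under eq_bigr do rewrite subr0.
  by rewrite mulrA ler_pM2r// invr_gt0.
rewrite /variance /expect !mean_N mulrA ler_pM2r ?invr_gt0//.
set m := (\sum_x f x) / N.
have g0 : \sum_x (f x - m) = 0.
  by rewrite sumrB sumr_const -[_ *+ _]mulr_natr -/N divfK ?subrr// gt_eqF.
have := h (fun x => f x - m) g0.
have -> // : \sum_x carre_du_champ P (fun x => f x - m) x = \sum_x carre_du_champ P f x.
apply: eq_bigr => x _; rewrite /carre_du_champ; congr (_ * _); apply: eq_bigr => y _.
by congr (_ * _ ^+ 2); ring.
Qed.

(** Makes the set under the infimum in [t_rel] nonempty; a crude constant is enough. Increments
    along generators are chained to reach every [z], and a centred [g x] is the average over [y] of
    [g x - g y]. *)
Lemma exists_poincare : exists c : R, forall g : X -> R, \sum_x g x = 0 ->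
  \sum_x g x ^+ 2 <= c * \sum_x carre_du_champ P g x.
Proof.
have h z : exists C : R, forall (g : X -> R) x,
    (g (x + z) - g x) ^+ 2 <= C * \sum_y carre_du_champ P g y.
  move: z; apply: (gen_zmod_ind S_gen) => [|z s sS [C hC]].
    by exists 0 => g x; rewrite addr0 subrr expr0n mul0r.
  (* From [(a + b) ^ 2 <= 2 a ^ 2 + 2 b ^ 2] and [sqr_increment_le]. *)
  exists (2 * C + 2 * (2 * #|S|%:R)) => g x.
  have h1 := hC g x; have h2 := sqr_increment_le g (x + z) sS.
  rewrite mulrDl -!mulrA addrA.
  have := sqr_ge0 (g (x + z + s) - g (x + z) - (g (x + z) - g x)); nra.
have [C hC] := choice h.
have E0 (g : X -> R) : 0 <= \sum_y carre_du_champ P g y.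
  by apply: sumr_ge0 => x _; exact: carre_du_champ_ge0.
exists (N * \sum_z `|C z|) => g g0.
have pw x : g x ^+ 2 <= (\sum_z `|C z|) * \sum_y carre_du_champ P g y.
  have -> : g x = \sum_y N^-1 * (g x - g y).
    by rewrite -mulr_sumr sumrB g0 subr0 sumr_const -[_ *+ _]mulr_natr mulrC mulfK// gt_eqF.
  have w0 (y : X) : 0 <= N^-1 by rewrite invr_ge0 ltW.
  have w1 : \sum_(y : X) N^-1 = 1.
    by rewrite sumr_const -[_ *+ _]mulr_natr mulVf ?gt_eqF.
  apply: le_trans (sqr_mean_le _ w0 w1) _.
  rewrite -[leRHS]mul1r -w1 mulr_suml; apply: ler_sum => y _; apply: (ler_wpM2l (w0 y)).
  have := hC (x - y) g y; rewrite subrKC => /le_trans; apply.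
  apply: ler_wpM2r => //; apply: le_trans (ler_norm _) _.
  by rewrite (bigD1 (x - y))//= lerDl sumr_ge0.
rewrite -mulrA mulrC mulr_natr -sumr_const; exact: ler_sum.
Qed.

(** The infimum is itself admissible: the quotient of the squared norm by the Dirichlet form is a
    lower bound of the admissible constants. If the form vanishes, any admissible constant already
    gives the claim. *)
Lemma t_rel_poincare (g : X -> R) : \sum_x g x = 0 ->
  \sum_x g x ^+ 2 <= t_rel P piu * \sum_x carre_du_champ P g x.
Proof.
move=> g0; have [c hc] := exists_poincare.
have E0 : 0 <= \sum_y carre_du_champ P g y.
  by apply: sumr_ge0 => x _; exact: carre_du_champ_ge0.
have [E|E] := eqVneq (\sum_y carre_du_champ P g y) 0.
  by rewrite E mulr0; have := hc g g0; rewrite E mulr0.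
have {}E0 : 0 < \sum_y carre_du_champ P g y by rewrite lt_def E.
rewrite -ler_pdivrMr//; apply: lb_le_inf; first by exists c; apply/poincare_uniform.
by move=> c' /poincare_uniform hc'; rewrite ler_pdivrMr//; exact: hc'.
Qed.

(** [sum_carre_du_champ_le], tested on the centred point mass at 0. This allows the hypothesis on
    [t_rel] to control quantities in which [t_rel] does not appear. *)
Lemma t_rel_ge_half : (1 < #|X|)%N -> 2^-1 <= t_rel P piu.
Proof.
move=> X1; have [c hc] := exists_poincare.
apply: lb_le_inf; first by exists c; apply/poincare_uniform.
move=> c' /poincare_uniform hc'.
pose g (x : X) : R := (0 == x)%:R - N^-1.
have N1 : 1 < N by rewrite ltr1n.
have s1 : \sum_(x : X) (0 == x)%:R = 1 :> R.
  by under eq_bigr do rewrite -[_%:R]mulr1; rewrite sum_delta.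
have g0 : \sum_x g x = 0.
  by rewrite sumrB s1 sumr_const -[_ *+ _]mulr_natr mulVf ?subrr// gt_eqF.
have gp : 0 < \sum_x g x ^+ 2.
  rewrite (bigD1 0)//=; apply: ltr_pwDl; last by apply: sumr_ge0 => *; exact: sqr_ge0.
  by rewrite /g eqxx exprn_gt0// subr_gt0 invf_lt1.
have := hc' g g0; have := sum_carre_du_champ_le g stP symP.
have E0 : 0 <= \sum_y carre_du_champ P g y.
  by apply: sumr_ge0 => x _; exact: carre_du_champ_ge0.
move=> E2 h; rewrite leNgt; apply/negP => clt.
have [E|E] := eqVneq (\sum_y carre_du_champ P g y) 0.
  by move: h; rewrite E mulr0 leNgt gp.
have : c' * \sum_x carre_du_champ P g x < 2^-1 * \sum_x carre_du_champ P g x.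
  by rewrite ltr_pM2r// lt_def E.
lra.
Qed.

End CayleyEquilibrium.

(** A single generator [s] would satisfy [s = - s] and generate only [0] and [s]. This is what makes
    [ln d] positive. *)
Lemma card_sym_generator_gt1 (X : finZmodType) (S : {set X}) : (3 <= #|X|)%N ->
  -%R @: S = S -> <<S>>%g = [set: X] -> (1 < #|S|)%N.
Proof.
move=> X3 S_sym S_gen; rewrite ltnNge; apply/negP => S1.
have [s sS] : exists s, S \subset [set s].
  have [S0|[s sS]] := set_0Vmem S; first by exists 0; rewrite S0 finset.sub0set.
  exists s; apply/fintype.subsetP => z zS; rewrite inE.
  by apply/eqP; apply: (fintype.card_le1_eqP S1).
have ss : s \in S -> s + s = 0.
  move=> sinS; have : - s \in S by rewrite -S_sym mem_imset//; exact: oppr_inj.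
  by move/(fintype.subsetP sS); rewrite inE => /eqP/(congr1 (+%R s)); rewrite subrr => <-.
have h x : x \in [set 0; s].
  move: x; apply: (gen_zmod_ind S_gen) => [|x z zS]; first by rewrite !inE eqxx.
  have /set1P zs := fintype.subsetP sS z zS; rewrite zs in zS *.
  by rewrite !inE => /orP[/eqP->|/eqP->]; rewrite ?add0r ?ss// eqxx ?orbT.
have : (#|X| <= #|[set (0%R : X); s]|)%N by apply: subset_leq_card; apply/fintype.subsetP => x _.
by rewrite cards2 leqNgt => /negP; apply; apply: leq_ltn_trans X3; case: (_ != _).
Qed.

(** * Lower bound on mixing times by counting words *)

Fixpoint word_ball (X : finZmodType) (S : {set X}) (k : nat) : {set X} :=
  if k is k'.+1 then word_ball S k' :|: [set x + s | x in word_ball S k', s in S]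
  else [set 0].

(** Each letter is a generator or a pause, hence the base [#|S|.+1]. *)
Lemma card_word_ball (X : finZmodType) (S : {set X}) k :
  (#|word_ball S k| <= #|S|.+1 ^ k)%N.
Proof.
elim: k => [|k IH] /=; first by rewrite cards1.
apply: leq_trans (leq_card_setU _ _) _.
apply: (@leq_trans (#|word_ball S k| + #|word_ball S k| * #|S|)).
  by rewrite leq_add2l -cardsX curry_imset2X; exact: leq_imset_card.
by rewrite -mulnS mulnC expnS leq_mul2l IH orbT.
Qed.

Lemma word_ball_sub (X : finZmodType) (S : {set X}) j k : (j <= k)%N ->
  word_ball S j \subset word_ball S k.
Proof.
move/subnKC <-; elim: (k - j)%N => [|m IH]; first by rewrite addn0.
by rewrite addnS /=; apply: fintype.subset_trans IH _; exact: finset.subsetUl.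
Qed.

Section LowerBound.
Variables (R : realType) (X : finZmodType) (S : {set X}).
Hypothesis (S0 : (0 < #|S|)%N).
Let P := @cayley_walk R X S.
Let stP : stochastic P := @cayley_stochastic R X S S0.

Lemma kernel_pow_word_ball k y : y \notin word_ball S k -> kernel_pow P k 0 y = 0.
Proof.
elim: k y => [y|k IH y].
  by rewrite /= inE eq_sym => /negbTE ->.
rewrite kernel_powSr /= !inE negb_or => /andP[yk yS].
rewrite big1// => z _; have [zk|zk] := boolP (z \in word_ball S k); last first.
  by rewrite IH ?mul0r.
rewrite /P cayley_walkE; case: (boolP (y - z \in S)) => [yz|]; last by rewrite !mulr0.
by case/imset2P: yS; exists z (y - z) => //; rewrite subrKC.
Qed.

(** Markov's inequality for the number of jumps, which is Poisson of mean [t]: leaving the ball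
    takes at least [k + 1] jumps. It is applied at each [y] through [egf_moment_le]. *)
Lemma heat_kernel_out_word_ball (t : R) k : 0 <= t ->
  k.+1%:R * \sum_(y in ~: word_ball S k) heat_kernel P t 0 y <= t.
Proof.
move=> t0; rewrite mulr_sumr.
apply: (@le_trans _ _ (\sum_(y in ~: word_ball S k) t * \sum_z heat_kernel P t 0 z * P z y)).
  apply: ler_sum => y; rewrite inE => yk.
  rewrite -sum_kernel_heat// -(ler_pM2l (expR_gt0 t)) mulrCA [leRHS]mulrCA.
  rewrite -egf_kernel_powS// heat_kernelE [expR t * _]mulrA -expRD subrr expR0 mul1r.
  apply: egf_le; first exact: kernel_pow_norm.
  move=> n; apply: le_trans (egf_moment_le n (kernel_pow_itv stP 0 y) t0).
  rewrite mulr_sumr; apply: ler_sum => j _.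
  have [kj|jk] := ltnP k j.
    rewrite ler_wpM2r ?ler_nat// !mulr_ge0 ?invr_ge0 ?exprn_ge0//.
    by have /andP[] := kernel_pow_itv stP 0 y j.
  rewrite kernel_pow_word_ball ?mul0r ?mulr0//.
  by apply: contra yk; exact: (fintype.subsetP (word_ball_sub S jk)).
rewrite -mulr_sumr ler_piMr//.
have <- : \sum_y \sum_z heat_kernel P t 0 z * P z y = 1.
  rewrite exchange_big /= -[RHS](sum_heat_kernel stP t 0); apply: eq_bigr => z _.
  by rewrite -mulr_sumr stP.2 mulr1.
rewrite [leRHS](bigID (mem (~: word_ball S k))) /= lerDl sumr_ge0// => y _.
by apply: sumr_ge0 => z _; rewrite mulr_ge0 ?heat_kernel_ge0//; exact: stP.1.
Qed.

(** The test event is the word ball: likely for the walk started at 0, small for the uniform law. *)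
Lemma worst_tv_lower_bound (t eps : R) k : 0 <= t ->
  worst_tv P (fun=> #|X|%:R^-1) t <= 1 - eps ->
  eps <= t / k.+1%:R + (#|S|.+1 ^ k)%:R / #|X|%:R.
Proof.
move=> t0 h; have N0 : 0 < (#|X|%:R : R) by rewrite ltr0n; apply/card_gt0P; exists 0.
have := le_trans (le_tv_dist _ _ (word_ball S k)) (le_trans (le_worst_tv P _ t 0) h).
rewrite ler_norml => /andP[_].
have out : \sum_(y in ~: word_ball S k) heat_kernel P t 0 y <= t / k.+1%:R.
  by rewrite ler_pdivlMr// mulrC; exact: heat_kernel_out_word_ball.
have : \sum_(y in word_ball S k) heat_kernel P t 0 y =
    1 - \sum_(y in ~: word_ball S k) heat_kernel P t 0 y.
  rewrite -(sum_heat_kernel stP t 0) [in RHS](bigID (mem (word_ball S k))) /=.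
  by rewrite [X in _ - X](eq_bigl (fun x => x \notin word_ball S k)) ?addrK// => x; rewrite inE.
rewrite sumr_const -[_^-1 *+ _]mulr_natr [_^-1 * _]mulrC.
have : #|word_ball S k|%:R / #|X|%:R <= (#|S|.+1 ^ k)%:R / #|X|%:R :> R.
  by rewrite ler_pM2r ?invr_gt0// ler_nat card_word_ball.
move=> h1 -> h2; move: out h1 h2.
set o := \sum_(_ in _) _; set b := _ / #|X|%:R; set b' := _ / #|X|%:R; set q := t / _.
lra.
Qed.

Lemma mixing_time_lower_bound (t eps : R) : (1 < #|S|)%N -> 0 <= t -> 0 < eps ->
  2 * ln (2 / eps) <= ln (#|X|%:R : R) ->
  worst_tv P (fun=> #|X|%:R^-1) t <= 1 - eps ->
  eps / 8 * (ln (#|X|%:R : R) / ln (#|S|%:R : R)) <= t.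
Proof.
move=> S1 t0 e0 hN h.
have N0 : 0 < (#|X|%:R : R) by rewrite ltr0n; apply/card_gt0P; exists 0.
set N : R := #|X|%:R in N0 hN h *; set d : R := #|S|%:R.
have d2 : 2 <= d by rewrite ler_nat.
have l0 : 0 < ln d by rewrite ln_gt0//; lra.
have dS : (#|S|.+1%:R : R) = d + 1 by rewrite -natr1.
have l1 : ln (d + 1) <= 2 * ln d.
  rewrite mulr_natl -lnXn; last lra.
  by rewrite ler_ln ?posrE ?exprn_gt0//; nra.
have l2 : 0 < ln (d + 1) by rewrite ln_gt0//; lra.
have lN : 0 <= ln N by rewrite ln_ge0// ler1n -(@ltr0n R).
(* With [k <= L] the ball has at most [sqrt N] points, a proportion at most [eps / 2] by the
   assumption on [N]. The final [eps / 8] is [eps / 2] times a half from this square root and a half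
   from [ln (d + 1) <= 2 ln d]. *)
set L := ln N / 2 / ln (d + 1).
have L0 : 0 <= L by rewrite !divr_ge0// ltW.
have /andP[kL Lk] := truncn_itv L0; set k := Num.truncn L in kL Lk.
have pk : (#|S|.+1 ^ k)%:R / N <= eps / 2.
  rewrite ler_pdivrMr// natrX dS -[d + 1]lnK ?posrE; last lra.
  rewrite -expRM_natl -[leRHS]lnK ?posrE ?mulr_gt0 ?divr_gt0// ler_expR.
  rewrite lnM ?posrE ?divr_gt0//.
  move: hN; rewrite -[2 / eps]invf_div lnV ?posrE ?divr_gt0// => hN.
  by move: kL; rewrite ler_pdivlMr//; lra.
have := worst_tv_lower_bound k t0 h => lb.
have {lb} : eps / 2 <= t / k.+1%:R 
  by move: lb pk; rewrite -/N; set b := _ / N; set q := t / _; lra.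
rewrite ler_pdivlMr// => lb.
have : eps / 2 * L <= t by apply: le_trans lb; rewrite ler_wpM2l ?divr_ge0 ?ltW.
apply: le_trans.
have : ln N / ln d <= 2 * (ln N / ln (d + 1)).
  rewrite ler_pdivrMr// (_ : _ * ln d = ln N * (2 * ln d) / ln (d + 1)); last by ring.
  by rewrite ler_pdivlMr// ler_wpM2l.
rewrite /L; set a := ln N / ln d => ha.
rewrite (_ : eps / 2 * _ = eps / 8 * (2 * (ln N / ln (d + 1)))); last by field; rewrite gt_eqF.
by rewrite ler_wpM2l// divr_ge0// ltW.
Qed.

End LowerBound.

(** * Cutoff *)

Section CayleyMixing.
Variables (R : realType) (X : finZmodType) (S : {set X}).
Hypotheses (X3 : (3 <= #|X|)%N) (S_sym : -%R @: S = S) (S_gen : <<S>>%g = [set: X]).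
Let P := @cayley_walk R X S.
Let u : X -> R := fun=> #|X|%:R^-1.
Let T := t_rel P u.
Let l := ln (#|S|%:R : R).

Let S1 : (1 < #|S|)%N. Proof. exact: card_sym_generator_gt1. Qed.
Let S0 : (0 < #|S|)%N. Proof. exact: ltnW. Qed.
Let stP : stochastic P := @cayley_stochastic R X S S0.
Let symP : symmetric_kernel P := cayley_symmetric R S_sym.
Let N0 : 0 < (#|X|%:R : R). Proof. by rewrite ltr0n (leq_trans _ X3). Qed.

Let T_ge : 2^-1 <= T.
Proof. by apply: t_rel_ge_half => //; exact: leq_trans X3. Qed.
Let T0 : 0 < T. Proof. by apply: lt_le_trans T_ge; rewrite invr_gt0. Qed.
Let poin := @t_rel_poincare R X S S0 S_gen.

(** [ln (1 + x) <= x] at [x = - 1 / 2] gives [ln 2 >= 1 / 2]. The explicit bound serves to absorb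
    additive constants into multiples of [l]. *)
Lemma ln_card_generators_ge : 2^-1 <= l.
Proof.
have h : ln 2 <= l by rewrite ler_ln ?posrE ?ltr0n// ler_nat.
apply: le_trans h; have e2 : expR (2^-1) ^+ 2 = expR 1 :> R.
  by rewrite expr2 -expRD; congr expR; lra.
have l2 := @le_ln1Dx R (- 2^-1); rewrite -[2^-1]opprK lerNl -lnV ?posrE//.
by rewrite (_ : 2^-1 = 1 + - 2^-1) ?l2//; lra.
Qed.

(** Makes the infimum in [t_mix] meaningful. It is [truncated_mixing] for a point mass with nothing
    truncated: [K = 1] and [delta = 0]. *)
Lemma mixing_times_nonempty (eps : R) : 0 < eps ->
  exists t, 0 <= t /\ worst_tv P u t <= eps.
Proof.
move=> e0; pose t := T * `|ln (#|X|%:R / eps ^+ 2)| .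
have t0 : 0 <= t by rewrite mulr_ge0// ltW.
exists t; split=> //; apply: worst_tv_le; first exact: ltW.
move=> x A.
pose p y : R := (x == y)%:R.
have p0 y : 0 <= p y by exact: ler0n.
have p1 : \sum_y p y = 1.
  by under eq_bigr do rewrite -[p _]mulr1; rewrite sum_delta.
have := @truncated_mixing R X P T t 1 0 eps p predT A stP symP T0 t0 poin p0 p1 ler01.
rewrite addr0 big_pred0// mulr1.
rewrite (eq_bigr (heat_kernel P t x)); last by move=> y _; rewrite sum_delta.
apply => //; [by move=> y _; rewrite /p; case: eqP | exact: ltW |].
have a0 : 0 < #|X|%:R / eps ^+ 2 by rewrite divr_gt0 ?exprn_gt0.
have -> : 2 * t / T = 2 * `|ln (#|X|%:R / eps ^+ 2)| by rewrite /t; field; rewrite gt_eqF.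
rewrite expRN ler_pdivrMr ?expR_gt0// mulrC -ler_pdivrMr ?exprn_gt0//.
rewrite -[leLHS]lnK ?posrE// ler_expR.
have := ler_norm (ln (#|X|%:R / eps ^+ 2)); have := normr_ge0 (ln (#|X|%:R / eps ^+ 2)).
lra.
Qed.

(** Truncation costs [eps / 4], and the relaxed part at most [eps / 2] once [2 w / T >= ln N + D +
    sigma + 2 ln (2 / eps)]. By [entropy_deficit_le], [2 sigma + 3 ln (2 / eps)] is enough for
    [2 w / T]. *)
Lemma mixing_window (s eps : R) : 0 < eps < 1 -> 1 <= s ->
  worst_tv P u s <= 1 - eps ->
  worst_tv P u (s + T * ((20 / Num.sqrt eps + 4 * ln (2 / eps)) * (l * Num.sqrt s))) <= eps.
Proof.
move=> /andP[e0 e1] s1 tvs; set w := T * _.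
have s0 : 0 < s by rewrite (lt_le_trans ltr01).
have l_ge := ln_card_generators_ge; have l0 : 0 < l by apply: lt_le_trans l_ge; rewrite invr_gt0.
have ss1 : 1 <= Num.sqrt s by rewrite -sqrtr1 ler_wsqrtr.
have le0 : 0 < ln (2 / eps) by rewrite ln_gt0// ltr_pdivlMr//; lra.
have se0 : 0 < Num.sqrt eps by rewrite sqrtr_gt0.
have w0 : 0 <= w.
  by rewrite !mulr_ge0 ?addr_ge0 ?divr_ge0 ?mulr_ge0 ?sqrtr_ge0// ltW.
apply: worst_tv_le; first exact: ltW.
move=> x A; set p := heat_kernel P s x.
have p0 y : 0 < p y by exact: heat_kernel_gt0.
have p1 : \sum_y p y = 1 by exact: sum_heat_kernel.
set D := \sum_y p y * ln (p y).
set sigma := 2 * Num.sqrt ((varentropy p + 1) / eps).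
have e01 : 0 < eps < 1 by rewrite e0 e1.
have [pB /(_ (le_trans (le_worst_tv P u s x) tvs)) hD] := entropy_deficit_le p0 p1 e01.
rewrite -/D -/sigma in pB hD.
have V : varentropy p <= s * (20 + 2 * l ^+ 2) by exact: varentropy_le.
(* This is [V + 1 <= (10 l) ^ 2 * s]: the additive constants are absorbed thanks to [s >= 1] and
   [l >= 1 / 2]. *)
have hs : sigma <= 20 / Num.sqrt eps * (l * Num.sqrt s).
  rewrite /sigma (_ : 20 / Num.sqrt eps * (l * Num.sqrt s) =
    2 * Num.sqrt ((10 * l) ^+ 2 * s / eps)); last first.
    have l10 : 0 <= 10 * l by rewrite mulr_ge0// ltW.
    rewrite sqrtrM; last by apply: mulr_ge0; [exact: sqr_ge0 | exact: ltW].
    rewrite sqrtrM; last exact: sqr_ge0.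
    rewrite sqrtr_sqr ger0_norm// sqrtrV ?(ltW e0)//.
    ring.
  rewrite ler_pM2l// ler_wsqrtr// ler_pM2r ?invr_gt0//.
  have l2 : 4^-1 <= l ^+ 2 by nra.
  have : s * 4^-1 <= s * l ^+ 2 by rewrite ler_pM2l.
  rewrite exprMn; move: V; set v := varentropy p; set l' := l ^+ 2; set sl := s * l'.
  rewrite mulrDr (mulrCA s 2) -/sl -[_ * s]mulrA [l' * s]mulrC -/sl; lra.
have hw : 2 * sigma + 4 * ln (2 / eps) <= 2 * w / T.
  rewrite (_ : 2 * w / T = 2 * ((20 / Num.sqrt eps + 4 * ln (2 / eps)) * (l * Num.sqrt s))); last first.
    by rewrite /w; move: (20 / _ + _) => c; field; rewrite gt_eqF.
  have : 2^-1 <= l * Num.sqrt s by nra.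
  move: hs le0; set ls := l * _; set q := _ * ls; set L := ln _.
  move=> hs le0 hls; have : L * 2^-1 <= L * ls by rewrite ler_pM2l.
  by rewrite [(_ + _) * ls]mulrDl -/q -[4 * L * ls]mulrA; set z := L * ls; lra.
rewrite (eq_bigr (fun y => \sum_z p z * heat_kernel P w z y)); last first.
  by move=> y _; rewrite heat_kernelD.
apply: (@le_trans _ _ (eps / 2 + eps / 4)); last lra.
apply: (@truncated_mixing R X P T w (expR (D + sigma)) _ _ p
   (fun y => ln (p y) <= D + sigma)) => //.
- by move=> y; exact: ltW.
- by move=> y h; rewrite -[p y]lnK ?posrE// ler_expR.
- by rewrite divr_ge0// ltW.
rewrite -[X in X * _ * _]lnK ?posrE// -!expRD -[eps / 2]lnK ?posrE ?divr_gt0//.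
rewrite -expRM_natl ler_expR -[eps / 2]invf_div lnV ?posrE ?divr_gt0//.
by set a := 2 * w / T in hw *; lra.
Qed.

(* [mixing_window] gives [t_mix P u eps <= (1 + kappa) * s] for every [s]
   admissible for [1 - eps], so that the infima need not be attained. *)
Lemma t_mix_window (eps kappa : R) : 0 < eps <= 2^-1 -> 0 <= kappa ->
  2 * ln (2 / eps) <= ln (#|X|%:R : R) ->
  8 / eps * l <= ln (#|X|%:R : R) ->
  8 * ((20 / Num.sqrt eps + 4 * ln (2 / eps)) * T) ^+ 2 * l ^+ 3 <=
    eps * kappa ^+ 2 * ln (#|X|%:R : R) ->
  [/\ 0 < t_mix P u (1 - eps), t_mix P u (1 - eps) <= t_mix P u eps &
    t_mix P u eps <= (1 + kappa) * t_mix P u (1 - eps)].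
Proof.
move=> /andP[e0 e2] k0 h1 h2 h3.
set C := 20 / _ + _ in h3.
have l_ge := ln_card_generators_ge; have l0 : 0 < l by apply: lt_le_trans l_ge; rewrite invr_gt0.
have e01 : 0 < eps < 1 by rewrite e0; lra.
have C0 : 0 <= C.
  have : 0 < ln (2 / eps) by rewrite ln_gt0// ltr_pdivlMr//; lra.
  by move=> /ltW ?; rewrite addr_ge0 ?divr_ge0 ?mulr_ge0 ?sqrtr_ge0.
set m := ln #|X|%:R in h1 h2 h3.
(* Ensures that admissible times are at least 1, as [mixing_window] requires. *)
have L1 : 1 <= eps / 8 * (m / l).
  by rewrite mulrA ler_pdivlMr// mul1r -ler_pdivrMl ?divr_gt0// invf_div.
have lb s : 0 <= s -> worst_tv P u s <= 1 - eps -> eps / 8 * (m / l) <= s.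
  by move=> s0 hs; exact: mixing_time_lower_bound.
have lb1 s : 0 <= s -> worst_tv P u s <= 1 - eps -> 1 <= s.
  by move=> s0 hs; apply: le_trans L1 (lb _ s0 hs).
have e1' : 0 < 1 - eps by lra.
have lbd c : lbound [set t : R | 0 <= t /\ worst_tv P u t <= c]%classic 0 by move=> t [].
split.
- apply: lt_le_trans ltr01 _; apply: lb_le_inf.
    by have [t ht] := mixing_times_nonempty e1'; exists t.
  by move=> s [s0 hs]; exact: lb1.
- apply: lb_le_inf; first by have [t ht] := mixing_times_nonempty e0; exists t.
  move=> s [s0 hs]; apply: ge_inf; first by exists 0; exact: lbd.
  by split=> //; apply: le_trans hs _; lra.
have k1 : 0 < 1 + kappa by rewrite ltr_wpDr.
rewrite mulrC -ler_pdivrMr//; apply: lb_le_inf.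
  by have [t ht] := mixing_times_nonempty e1'; exists t.
move=> s [s0 hs]; rewrite ler_pdivrMr//.
have s1 := lb1 _ s0 hs; have sL := lb _ s0 hs.
have := mixing_window e01 s1 hs; rewrite -/C => hw.
apply: (@le_trans _ _ (s + T * (C * (l * Num.sqrt s)))).
  apply: ge_inf; first by exists 0; exact: lbd.
  split=> //; rewrite addr_ge0// mulr_ge0 ?(ltW T0)// mulr_ge0// mulr_ge0 ?sqrtr_ge0// ltW//.
rewrite mulrDr mulr1 lerD2l.
have sq := sqr_sqrtr s0; have r0 : 0 < Num.sqrt s by rewrite sqrtr_gt0 (lt_le_trans ltr01).
set r := Num.sqrt s in sq r0 *.
(* The window has to be at most [kappa * s]. Squared, and with [s] replaced by its lower bound
   [eps / 8 * (m / l)], this is [h3]. *)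
suff main : T * C * l <= kappa * r.
  rewrite (_ : T * _ = T * C * l * r); last by ring.
  by rewrite (_ : s * kappa = kappa * r * r) ?ler_pM2r// -sq; ring.
rewrite -ler_sqr ?nnegrE; last 2 first.
- by rewrite !mulr_ge0// ltW.
- by rewrite mulr_ge0// ltW.
rewrite [leRHS]exprMn sq.
have : kappa ^+ 2 * (eps / 8 * (m / l)) <= kappa ^+ 2 * s by rewrite ler_wpM2l ?sqr_ge0.
apply: le_trans; rewrite (_ : kappa ^+ 2 * _ = eps * kappa ^+ 2 * m / (8 * l)); last first.
  by field; rewrite gt_eqF.
rewrite ler_pdivlMr ?mulr_gt0//; apply: le_trans h3.
by rewrite le_eqVlt; apply/orP; left; apply/eqP; ring.
Qed.

End CayleyMixing.

Lemma sqr_relaxation_condition (R : realType) (T l m : R) : 0 <= l -> 0 <= m ->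
  (T * (l `^ (3 / 2) / m `^ (1 / 2))) ^+ 2 = T ^+ 2 * l ^+ 3 / m.
Proof.
move=> l0 m0; have sq (x y : R) : 0 <= x -> (x `^ (y / 2)) ^+ 2 = x `^ y.
  by move=> x0; rewrite -powR_mulrn ?powR_ge0// -powRrM divfK.
by rewrite !exprMn exprVn !sq// powRr1// powR_mulrn// mulrA.
Qed.

(** For [eps > 1 / 2] the ratio is the inverse of the one at [1 - eps]. *)
Lemma cutoff_of_ratio (R : realType) (tmix : nat -> R -> R) :
  (forall eps kappa : R, 0 < eps <= 2^-1 -> 0 < kappa -> \forall n \near \oo%classic,
    [/\ 0 < tmix n (1 - eps), tmix n (1 - eps) <= tmix n eps &
      tmix n eps <= (1 + kappa) * tmix n (1 - eps)]) ->
  cutoff tmix.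
Proof.
move=> h eps /andP[e0 e1]; apply/cvgrPdist_le => kappa k0.
have [e2|e2] := leP eps 2^-1.
  have e02 : 0 < eps <= 2^-1 by rewrite e0.
  apply: filterS (h eps kappa e02 k0) => n [a0 ab bk].
  have b0 := lt_le_trans a0 ab.
  rewrite ger0_norm; last by rewrite subr_ge0 ler_pdivrMr// mul1r.
  by rewrite lerBlDr -lerBlDl ler_pdivlMr//; nra.
have e02 : 0 < 1 - eps <= 2^-1 by apply/andP; split; lra.
apply: filterS (h (1 - eps) kappa e02 k0) => n.
rewrite subKr => -[a0 ab bk].
rewrite distrC ger0_norm; last by rewrite subr_ge0 ler_pdivlMr// mul1r.
by rewrite lerBlDl ler_pdivrMr.
Qed.

Theorem corollary3 (R : realType)
    (X : nat -> finZmodType) (S : forall n : nat, {set X n})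
    (pi : forall n : nat, X n -> R)
    (card_ge3 : forall n : nat, (3 <= #|X n|)%N)
    (S_sym : forall n : nat, -%R @: S n = S n)
    (S_gen : forall n : nat, <<S n>>%g = [set: X n])
    (pi_inv : forall n : nat, invariant_law (@cayley_walk R (X n) (S n)) (pi n))
    (cond : ((fun n : nat =>
       t_rel (@cayley_walk R (X n) (S n)) (pi n) *
       ((ln (#|S n|%:R : R) `^ (3 / 2)) / (ln (#|X n|%:R : R) `^ (1 / 2))))
       @ \oo --> (0 : R))%classic) :
  cutoff (fun n => t_mix (@cayley_walk R (X n) (S n)) (pi n)).
Proof.
have S1 n : (1 < #|S n|)%N by exact: card_sym_generator_gt1.
have S0 n : (0 < #|S n|)%N by exact: ltnW.
have piE n : pi n = fun=> #|X n|%:R^-1.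
  exact: (invariant_law_uniform (S0 n) (S_sym n) (S_gen n)).
apply: cutoff_of_ratio => eps kappa e02 k0; have /andP[e0 e2] := e02.
set C := 20 / Num.sqrt eps + 4 * ln (2 / eps).
have L0 : 0 < ln (2 / eps) by rewrite ln_gt0// ltr_pdivlMr//; lra.
(* One threshold on [T ^ 2 * l ^ 3 / m] for each of the three size conditions of [t_mix_window]; the
   [+ 1] in [d3] keeps its denominator positive. *)
pose d1 := (64 * ln (2 / eps))^-1; pose d2 := eps / 128.
pose d3 := eps * kappa ^+ 2 / (8 * (C ^+ 2 + 1)).
have C0 : 0 < C ^+ 2 + 1 by rewrite ltr_wpDl ?sqr_ge0.
have d10 : 0 < d1 by rewrite invr_gt0 mulr_gt0.
have d20 : 0 < d2 by rewrite divr_gt0.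
have d30 : 0 < d3 by rewrite divr_gt0 ?mulr_gt0 ?exprn_gt0.
pose delta := Num.min d1 (Num.min d2 d3).
have delta0 : 0 < delta by rewrite !lt_min d10 d20 d30.
move/cvgrPdist_le : cond => /(_ (Num.sqrt delta)); rewrite sqrtr_gt0 => /(_ delta0).
apply: filterS => n; rewrite sub0r normrN.
rewrite -ler_sqr ?nnegrE ?sqrtr_ge0// sqr_sqrtr ?(ltW delta0)// real_normK ?num_real//.
have l2 := @ln_card_generators_ge R (X n) (S n) (card_ge3 n) (S_sym n) (S_gen n).
have T2 : 2^-1 <= t_rel (@cayley_walk R (X n) (S n)) (pi n).
  by rewrite piE; apply: t_rel_ge_half => //; exact: leq_trans (card_ge3 n).
have m0 : 0 < ln (#|X n|%:R : R) by rewrite ln_gt0// ltr1n (leq_trans _ (card_ge3 n)).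
have l0 : 0 < ln (#|S n|%:R : R) by rewrite ln_gt0// ltr1n.
rewrite sqr_relaxation_condition ?(ltW l0) ?(ltW m0)// ler_pdivrMr// !piE.
have window := @t_mix_window R (X n) (S n) (card_ge3 n) (S_sym n) (S_gen n) eps kappa
  e02 (ltW k0).
move: window T2; rewrite piE -/C.
set T := t_rel _ _; set l := ln _ in l2 l0 *; set m := ln _ in m0 *.
move=> window T2 Tlm.
(* As [T] and [l] are at least [1 / 2], [T ^ 2 * l ^ 3] dominates both [1 / 32] and [l / 16]. Its
   smallness relative to [m] thus also forces [m] to be large and [l / m] to be small. *)
have T4 : 4^-1 <= T ^+ 2 by nra.
have l4 : 4^-1 * l <= l ^+ 3 by rewrite exprSr ler_pM2r//; nra.
have Tl : l / 16 <= T ^+ 2 * l ^+ 3.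
  apply: le_trans (ler_pM _ _ T4 l4); rewrite ?mulr_ge0 ?invr_ge0//; lra.
have le_delta d : delta <= d -> T ^+ 2 * l ^+ 3 <= d * m.
  by move=> dd; apply: le_trans Tlm _; rewrite ler_pM2r.
have := le_delta d1; have := le_delta d2; have := le_delta d3.
rewrite !ge_min !lexx !orbT => /(_ isT) Td3 /(_ isT) Td2 /(_ isT) Td1.
apply: window.
- have : 32^-1 <= d1 * m by lra.
  by rewrite /d1 [_^-1 * m]mulrC ler_pdivlMr ?mulr_gt0//; lra.
- have : l / 16 <= d2 * m by lra.
  rewrite /d2 => h; rewrite mulrAC ler_pdivrMr//; lra.
- have c0 : 0 <= C ^+ 2 by exact: sqr_ge0.
  move: Td3; rewrite (_ : d3 * m = eps * kappa ^+ 2 * m / (8 * (C ^+ 2 + 1))); last first.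
    by rewrite /d3 mulrAC.
  rewrite ler_pdivlMr ?mulr_gt0//; apply: le_trans.
  have : 0 <= T ^+ 2 * l ^+ 3 by rewrite mulr_ge0 ?sqr_ge0// exprn_ge0// ltW.
  by rewrite exprMn; set C2 := C ^+ 2; nra.
Qed.
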